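(* There exists a regular local ring $(R,\mathfrak{m}_R)$ of dimension $2$ and a discrete, rank $1$ valuation $\nu$ of the quotient field of $R$ dominating $R$, such that the function $\alpha(n)=\ell_R(I_n/I_{n+1})$ is not a quasi-polynomial plus a bounded function for large integers $n$.
   Context: A valuation $\nu$ of the quotient field $K$ of $R$ has valuation ring $V_{\nu}=\{f\in K\mid \nu(f)\ge 0\}$ with maximal ideal $\mathfrak{m}_{\nu}=\{f\in K\mid \nu(f)>0\}$; it dominates $R$ if $R\subset V_{\nu}$ and $R\cap\mathfrak{m}_{\nu}=\mathfrak{m}_R$. It is discrete (of rank 1) if its value group is order isomorphic to $\mathbb{Z}$, and the value group is then identified with $\mathbb{Z}$. For $n\in\mathbb{Z}_{\ge 0}$, $I_n=\{f\in R\mid \nu(f)\ge n\}$. $\ell_R$ denotes length as an $R$-module. A quasi-polynomial in $n$ is an expression $a_d(n)n^d+a_{d-1}(n)n^{d-1}+\dots+a_1(n)n+a_0(n)$ whose coefficients $a_0(n),\dots,a_d(n)$ are (real-valued) periodic functions of the integer $n$, with integral period. A function $f$ is ''a quasi-polynomial plus a bounded function for large integers $n$'' if there are a quasi-polynomial $Q(n)$, a bounded function $\sigma(n)$ and an integer $n_0$ with $f(n)=Q(n)+\sigma(n)$ for all integers $n\ge n_0$. *)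

(* Defs.v *)
From HB Require Import structures.
From mathcomp Require Import all_boot all_order all_algebra.
From mathcomp Require Import reals.

Set Implicit Arguments.
Unset Strict Implicit.
Unset Printing Implicit Defensive.

Import Order.TTheory GRing.Theory Num.Theory.

Local Open Scope ring_scope.

(* Ideals and submodules are boolean predicates, as in ssralg and
   ring_quotient; under the classical axioms of boolp these are all subsets. *)

Definition strict_subset (T : Type) (A B : {pred T}) : Prop :=
  {subset A <= B} /\ ~ {subset B <= A}.

(* A chain N 0 < N 1 < ... < N l has length l, the number of its strict
   inclusions; the values N i for i > l are irrelevant. *)
Definition strict_chain (T : Type) (P : {pred T} -> Prop) (l : nat)
    (N : nat -> {pred T}) : Prop :=
  (forall i, (i <= l)%N -> P (N i)) /\
  (forall i, (i < l)%N -> strict_subset (N i) (N i.+1)).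

Definition max_chain_length (T : Type) (P : {pred T} -> Prop) (l : nat)
    : Prop :=
  (exists N, strict_chain P l N) /\
  (forall l' N, strict_chain P l' N -> (l' <= l)%N).

Definition has_length (R : nzRingType) (M : lmodType R) (l : nat) : Prop :=
  max_chain_length (fun N : {pred M} => submod_closed N) l.

(* A bundled submodule. GRing.submodClosed alone records only a sub-semimodule,
   without the closure under opposite that Quotient.quot needs. *)
Record submod (R : nzRingType) (V : lmodType R) :=
  Submod { submod_pred :> {pred V}; submodP : submod_closed submod_pred }.

HB.instance Definition _ (R : nzRingType) (V : lmodType R) (A : submod V) :=
  GRing.isSubmodClosed.Build R V (submod_pred A)
    (GRing.submod_closed_semi (submodP A)).

Section QuotientModule.
Variables (R : nzRingType) (V : lmodType R) (B : submod V).

Local Notation quotB := {ideal_quot (submod_pred B)}.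

Definition quot_scale (a : R) (x : quotB) : quotB :=
  \pi_quotB%qT (a *: repr x).

Lemma pi_quot_scale a v :
  quot_scale a (\pi_quotB%qT v) = \pi_quotB%qT (a *: v).
Proof.
apply/eqP; rewrite -Quotient.idealrBE -scalerBr rpredZ //.
by rewrite Quotient.idealrBE reprK.
Qed.

Lemma quot_scaleA a b x :
  quot_scale a (quot_scale b x) = quot_scale (a * b) x.
Proof. by rewrite -[x]reprK (pi_quot_scale b) !pi_quot_scale scalerA. Qed.

Lemma quot_scale1 : left_id 1 quot_scale.
Proof. by move=> x; rewrite -[x]reprK pi_quot_scale scale1r. Qed.

Lemma quot_scaleDr : right_distributive quot_scale +%R.
Proof.
move=> a x y; rewrite -[x]reprK -[y]reprK -raddfD !pi_quot_scale.
by rewrite scalerDr raddfD.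
Qed.

Lemma quot_scaleDl x : {morph quot_scale^~ x : a b / a + b}.
Proof. by move=> a b; rewrite -[x]reprK !pi_quot_scale scalerDl raddfD. Qed.

HB.instance Definition _ := GRing.Zmodule_isLmodule.Build R quotB
  quot_scaleA quot_scale1 quot_scaleDr quot_scaleDl.

End QuotientModule.

Section SubQuotient.
Variables (R : nzRingType) (V : lmodType R) (A B : submod V).

Definition submodule : Type := {x : V | x \in A}.
HB.instance Definition _ := [isSub of submodule for sval].
HB.instance Definition _ := [Choice of submodule by <:].
HB.instance Definition _ := [SubChoice_isSubLmodule of submodule by <:].

Lemma trace_closed : submod_closed [pred x : submodule | val x \in B].
Proof.
split; first by rewrite inE raddf0 rpred0.
move=> a x y; rewrite !inE => xB yB; rewrite -/(_ \in B).
by rewrite [val _](_ : _ = a *: val x + val y) // rpredD // rpredZ.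
Qed.

(* A / (A :&: B), which is A / B when B is contained in A *)
Definition quotient_module : lmodType R :=
  {ideal_quot (submod_pred (Submod trace_closed))}.

End SubQuotient.

Section RegularLocal.
Variable R : comNzRingType.

Definition generates (s : seq R) (I : {pred R}) : Prop :=
  forall x, x \in I <-> exists c : nat -> R, x = \sum_(i < size s) c i * s`_i.

Definition noetherian : Prop :=
  forall I : {pred R^o}, submod_closed I -> exists s, generates s I.

Definition maximal_ideal (m : {pred R}) : Prop :=
  idealr_closed m /\
  (forall J : {pred R}, idealr_closed J -> {subset m <= J} -> J =i m).

Definition local_ring (m : {pred R}) : Prop :=
  maximal_ideal m /\ (forall m', maximal_ideal m' -> m' =i m).

Definition prime_ideal (P : {pred R}) : Prop :=
  idealr_closed P /\ prime_idealr_closed P.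

Definition krull_dim (d : nat) : Prop := max_chain_length prime_ideal d.

Definition regular_local_ring (m : {pred R}) (d : nat) : Prop :=
  [/\ noetherian, local_ring m, krull_dim d
    & exists2 s : seq R, size s = d & generates s m].

End RegularLocal.

(* The value at 0, which should be +oo, is a junk value: 0 is treated apart
   below. Surjectivity says that the value group is all of int, i.e. that it
   has been identified with the integers. *)
Record discrete_valuation (K : fieldType) := DiscreteValuation {
  dval :> K -> int;
  dvalM : forall f g, f != 0 -> g != 0 -> dval (f * g) = dval f + dval g;
  dvalD : forall f g, f != 0 -> g != 0 -> f + g != 0 ->
    Num.min (dval f) (dval g) <= dval (f + g);
  dval_surj : forall z : int, exists2 f, f != 0 & dval f = z }.

Section Valuation.
Variables (K : fieldType) (nu : discrete_valuation K).

Definition val_ge (n : int) : {pred K} := [pred f | (f == 0) || (n <= nu f)].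

Definition valuation_ring : {pred K} := val_ge 0.

Definition valuation_max_ideal : {pred K} := [pred f | (f == 0) || (0 < nu f)].

Lemma val_geD n f g : f \in val_ge n -> g \in val_ge n -> f + g \in val_ge n.
Proof.
have [->|f0] := eqVneq f 0; first by rewrite add0r.
have [->|g0] := eqVneq g 0; first by rewrite addr0.
rewrite !inE (negPf f0) (negPf g0) /= => nf ng.
have [//|fg0 /=] := eqVneq (f + g) 0.
by apply: le_trans (dvalD nu f0 g0 fg0); rewrite le_min nf.
Qed.

Lemma val_geM n f g :
  f \in valuation_ring -> g \in val_ge n -> f * g \in val_ge n.
Proof.
have [->|f0] := eqVneq f 0; first by rewrite mul0r !inE eqxx.
have [->|g0] := eqVneq g 0; first by rewrite mulr0 !inE eqxx.
rewrite !inE (negPf f0) (negPf g0) mulf_eq0 (negPf f0) (negPf g0) /= => nf ng.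
by rewrite dvalM // -[n]add0r lerD.
Qed.

End Valuation.

Definition dominates (R : idomainType) (m : {pred R})
    (nu : discrete_valuation {fraction R}) : Prop :=
  (forall f : R, tofrac f \in valuation_ring nu) /\
  (forall f : R, (tofrac f \in valuation_max_ideal nu) = (f \in m)).

Section ValuationIdeal.
Variables (R : idomainType) (m : {pred R}).
Variables (nu : discrete_valuation {fraction R}) (dom : dominates m nu).

Lemma valuation_ideal_closed (n : nat) :
  submod_closed [pred f : R^o | tofrac (f : R) \in val_ge nu n].
Proof.
split; first by rewrite !inE tofrac0 eqxx.
move=> a f g nf ng; rewrite inE tofracD tofracM.
by apply: val_geD => //; apply: val_geM => //; case: dom.
Qed.

Definition valuation_ideal (n : nat) : submod R^o :=
  Submod (valuation_ideal_closed n).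

End ValuationIdeal.

Section QuasiPolynomial.
Variable T : realType.

Definition int_periodic (a : int -> T) : Prop :=
  exists2 p : int, 0 < p & forall n, a (n + p) = a n.

Definition quasi_polynomial (Q : int -> T) : Prop :=
  exists d (a : 'I_d.+1 -> int -> T),
    (forall i, int_periodic (a i)) /\
    (forall n, Q n = \sum_(i < d.+1) a i n * n%:~R ^+ i).

Definition bounded_fun (s : int -> T) : Prop :=
  exists M : T, forall n, `|s n| <= M.

Definition eventually_quasi_polynomial_plus_bounded (f : nat -> T) : Prop :=
  exists Q s, [/\ quasi_polynomial Q, bounded_fun s
    & exists n0 : nat, forall n, (n0 <= n)%N -> f n = Q n + s n].

End QuasiPolynomial.

(* Main.v *)
From HB Require Import structures.
Require Import Defs.
From mathcomp Require Import all_boot all_order all_algebra all_field.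
From mathcomp Require Import boolp reals polyrcf ring lra zify.

(** Let [y = sum_i a_i t^(b_i)] be a power series over the algebraic closure [L]
    of F_2, where [a_0, ..., a_(i-1)] lie in the field [K_i] with [2^(2^i)]
    elements, [a_i] does not, and [b_i] grows very fast. The ring [R] is
    F_2[X, Y] localized at the origin, embedded in L[[t]] by [X -> t],
    [Y -> y], and the valuation is the order in [t]. (The embedding is
    injective because a polynomial killing [Y -> y] also kills infinitely many
    truncations of [y].) Taking the [n]-th coefficient embeds
    [I_n / I_(n+1)] in [L].

    - If [n < b_j] this coefficient depends only on the truncation of [y] at
      [b_j], hence lies in [K_j]; so the length is at most the cardinality of
      [K_j], which makes it at most [sqrt n].
    - The product of the conjugates of [Y - y_j], with [y_j] the truncation of
      [y], has leading coefficient [a_j] times an element of [K_j], hence in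
      [K_(j+1)] but not in [K_j]. Multiplying by powers of [X], for large [n]
      all of [K_0, ..., K_k] cut out distinct submodules of [I_n / I_(n+1)],
      so the length is unbounded.

    A quasi-polynomial that grows at most like [sqrt n] is bounded. *)

Set Implicit Arguments.
Unset Strict Implicit.
Unset Printing Implicit Defensive.

Import Order.TTheory GRing.Theory Num.Theory.

Local Open Scope ring_scope.

(** * Power series *)

Section PowerSeries.
Variable L : fieldType.

Definition fps : Type := nat -> L.

HB.instance Definition _ := Choice.copy fps (nat -> L).

Implicit Types f g h : fps.

Lemma fpsP f g : (forall n, f n = g n) <-> f = g.
Proof. by split=> [|-> //]; exact: funext. Qed.

Definition fps_add f g : fps := fun n => f n + g n.
Definition fps_opp f : fps := fun n => - f n.
Definition fps0 : fps := fun=> 0.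

Lemma fps_addA : associative fps_add.
Proof. by move=> f g h; apply/fpsP => n; apply: addrA. Qed.

Lemma fps_addC : commutative fps_add.
Proof. by move=> f g; apply/fpsP => n; apply: addrC. Qed.

Lemma fps_add0 : left_id fps0 fps_add.
Proof. by move=> f; apply/fpsP => n; apply: add0r. Qed.

Lemma fps_addN : left_inverse fps0 fps_opp fps_add.
Proof. by move=> f; apply/fpsP => n; apply: addNr. Qed.

HB.instance Definition _ :=
  GRing.isZmodule.Build fps fps_addA fps_addC fps_add0 fps_addN.

Definition fps_trunc n f : {poly L} := \poly_(i < n) f i.

(* Routing the product through polynomials lets the ring laws be inherited
   from {poly L}. *)
Definition fps_mul f g : fps :=
  fun n => (fps_trunc n.+1 f * fps_trunc n.+1 g)`_n.

Definition fps1 : fps := fun n => (n == 0)%:R.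

Lemma coef_polyM_congr n (p q p' q' : {poly L}) :
    (forall i, (i <= n)%N -> p`_i = p'`_i) ->
    (forall i, (i <= n)%N -> q`_i = q'`_i) ->
  (p * q)`_n = (p' * q')`_n.
Proof.
move=> pp' qq'; rewrite !coefM; apply: eq_bigr => i _.
by rewrite pp' ?qq' ?leq_subr // -ltnS.
Qed.

Lemma coef_fps_trunc n f i : (i < n)%N -> (fps_trunc n f)`_i = f i.
Proof. by move=> ltin; rewrite coef_poly ltin. Qed.

Lemma fps_mul_trunc n m f g :
  (n < m)%N -> fps_mul f g n = (fps_trunc m f * fps_trunc m g)`_n.
Proof.
by move=> ltnm; apply: coef_polyM_congr => i lein;
  rewrite !coef_fps_trunc ?ltnS // (leq_ltn_trans lein).
Qed.

Lemma fps_mulA : associative fps_mul.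
Proof.
move=> f g h; apply/fpsP => n; pose T := fps_trunc n.+1.
transitivity ((T f * (T g * T h))`_n).
  apply: coef_polyM_congr => i lein //.
  by rewrite coef_fps_trunc ?ltnS // (@fps_mul_trunc _ n.+1).
rewrite mulrA; apply: coef_polyM_congr => i lein //.
by rewrite coef_fps_trunc ?ltnS // (@fps_mul_trunc _ n.+1).
Qed.

Lemma fps_mulC : commutative fps_mul.
Proof. by move=> f g; apply/fpsP => n; rewrite /fps_mul mulrC. Qed.

Lemma fps_mul1 : left_id fps1 fps_mul.
Proof.
move=> f; apply/fpsP => n; rewrite -[RHS](@coef_fps_trunc n.+1) //.
rewrite -[fps_trunc n.+1 f in RHS]mul1r; apply: coef_polyM_congr => i lein //.
by rewrite coef_fps_trunc // coef1.
Qed.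

Lemma fps_mulDl : left_distributive fps_mul fps_add.
Proof.
move=> f g h; apply/fpsP => n; rewrite /fps_add /fps_mul -coefD -mulrDl.
by apply: coef_polyM_congr => i lein //; rewrite coefD !coef_fps_trunc.
Qed.

Lemma fps1_neq0 : fps1 != fps0.
Proof.
by apply/eqP => /fpsP/(_ 0); apply/eqP; rewrite /fps1 /fps0 eqxx oner_eq0.
Qed.

HB.instance Definition _ := GRing.Zmodule_isComNzRing.Build fps
  fps_mulA fps_mulC fps_mul1 fps_mulDl fps1_neq0.

Lemma fps_coefD f g n : (f + g) n = f n + g n. Proof. by []. Qed.
Lemma fps_coefN f n : (- f) n = - f n. Proof. by []. Qed.

Lemma fps_coefM f g n : (f * g) n = \sum_(i < n.+1) f i * g (n - i)%N.
Proof.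
rewrite [LHS]coefM; apply: eq_bigr => i _.
by rewrite !coef_fps_trunc ?ltnS ?leq_subr // -ltnS.
Qed.

Lemma fps_coef0M f g : (f * g) 0%N = f 0%N * g 0%N.
Proof. by rewrite fps_coefM big_ord1. Qed.

(** Below [n + m] every term of the Cauchy product has a vanishing factor, and at [n + m] only the
    term [i = n] survives. The indices are lower bounds for the orders, so the lemma also serves
    when the coefficient at [n] or [m] may be zero. *)
Lemma fps_coefM_ord f g n m :
    (forall i, (i < n)%N -> f i = 0) -> (forall i, (i < m)%N -> g i = 0) ->
  (forall i, (i < n + m)%N -> (f * g) i = 0) /\ (f * g) (n + m)%N = f n * g m.
Proof.
move=> fn gm; split=> [k ltk|].
  rewrite fps_coefM big1 // => i _; have [lti|lei] := ltnP i n.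
    by rewrite fn ?mul0r.
  by rewrite gm ?mulr0 //; have := ltn_ord i; lia.
have ltn : (n < (n + m).+1)%N by lia.
rewrite fps_coefM (bigD1 (Ordinal ltn)) //= addKn big1 ?addr0 // => i /eqP ni.
have [lti|lei] := ltnP i n; first by rewrite fn ?mul0r.
rewrite gm ?mulr0 //; have : nat_of_ord i <> n by move=> e; apply/ni/val_inj.
by have := ltn_ord i; lia.
Qed.

Definition ord_spec f n := (forall i, (i < n)%N -> f i = 0) /\ f n != 0.

Definition fps_ord f : nat :=
  if pselect (exists n, f n != 0) is left exf then ex_minn exf else 0.

Lemma fps_ordP f : f != 0 -> ord_spec f (fps_ord f).
Proof.
move=> f0; have exf : exists n, f n != 0.
  apply: contrapT => nex; case/eqP: f0; apply/fpsP => n.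
  by case: (eqVneq (f n) 0) => // fn0; case: nex; exists n.
rewrite /fps_ord; case: pselect => // {}exf; case: ex_minnP => n fn0 minn.
split=> // i ltin; apply/eqP; apply: contraTT ltin => /minn.
by rewrite -leqNgt.
Qed.

Lemma fps_ord_neq0 f n : f n != 0 -> f != 0.
Proof. by apply: contraNneq => ->. Qed.

Lemma fps_ordE f n : ord_spec f n -> fps_ord f = n.
Proof.
case=> fn fn0; have [fm fm0] := fps_ordP (fps_ord_neq0 fn0).
case: (ltngtP (fps_ord f) n) => // [/fn | /fm] /eqP.
  by rewrite (negPf fm0).
by rewrite (negPf fn0).
Qed.

Lemma fps_ord_ge f n :
  f != 0 -> (n <= fps_ord f)%N <-> (forall i, (i < n)%N -> f i = 0).
Proof.
move=> /fps_ordP[fm fm0]; split=> [len i lti|fn].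
  by apply: fm; apply: leq_trans len.
by rewrite leqNgt; apply: contraNN fm0 => /fn->.
Qed.

Lemma fps_ord_specM f g : f != 0 -> g != 0 ->
  ord_spec (f * g) (fps_ord f + fps_ord g)%N.
Proof.
move=> /fps_ordP[fn fn0] /fps_ordP[gm gm0].
have [fg fgE] := fps_coefM_ord fn gm.
by split; rewrite ?fgE ?mulf_neq0.
Qed.

Lemma fps_mulf_eq0 f g : f * g = 0 -> (f == 0) || (g == 0).
Proof.
move=> fg0; apply: contraT; rewrite negb_or => /andP[f0 g0].
by have [_] := fps_ord_specM f0 g0; rewrite fg0 eqxx.
Qed.

Lemma fps_ordM f g : f != 0 -> g != 0 ->
  fps_ord (f * g) = (fps_ord f + fps_ord g)%N.
Proof. by move=> f0 g0; apply/fps_ordE/fps_ord_specM. Qed.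

Lemma fps_ordD f g : f != 0 -> g != 0 -> f + g != 0 ->
  (minn (fps_ord f) (fps_ord g) <= fps_ord (f + g)%R)%N.
Proof.
move=> f0 g0 fg0; apply/fps_ord_ge => // i; rewrite leq_min => /andP[lif lig].
by rewrite fps_coefD (fps_ordP f0).1 // (fps_ordP g0).1 ?addr0.
Qed.

Lemma fps_coefX f n i : f 0%N = 0 -> (i < n)%N -> (f ^+ n) i = 0.
Proof.
move=> f0; elim: n i => // n IHn i ltin.
by rewrite exprS (@fps_coefM_ord _ _ 1 n _ IHn).1 // => -[].
Qed.

(* With c f = 1 - u the inverse is c times the geometric series in u; its
   coefficient n only involves the first n.+1 powers of u. *)
Lemma fps_inv_exists f : f 0%N != 0 -> exists g, f * g = 1.
Proof.
move=> f00; pose c : fps := fun n => (n == 0)%:R * (f 0%N)^-1.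
pose u := 1 - c * f; have u0 : u 0%N = 0.
  by rewrite /u fps_coefD fps_coefN fps_coef0M /c mul1r mulVf // subrr.
pose S n : fps := \sum_(i < n) u ^+ i.
have SE n m : (m < n)%N -> S n m = S m.+1 m.
  elim: n => // n IHn; rewrite ltnS leq_eqVlt => /predU1P[-> // | ltmn].
  by rewrite /S big_ord_recr /= fps_coefD fps_coefX // addr0 -/(S _) IHn.
pose g : fps := fun n => S n.+1 n.
suff cfg : (c * f) * g = 1 by exists (c * g); rewrite mulrCA mulrA.
apply/fpsP => n; transitivity ((c * f * S n.+1) n).
  rewrite !fps_coefM; apply: eq_bigr => i _; congr (_ * _).
  by rewrite SE // ltnS leq_subr.
have -> : c * f = 1 - u by rewrite /u subKr.
have /esym := subrX1 u n.+1; rewrite -/(S _) => /(congr1 -%R).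
rewrite -mulNr !opprB => ->.
by rewrite fps_coefD fps_coefN fps_coefX // subr0.
Qed.

End PowerSeries.

(** * Localization inside a power series ring *)

Section Generators.
Variable R : comNzRingType.
Implicit Types (s t : seq R) (I : {pred R^o}) (x y : R).

Definition in_span s x : Prop :=
  exists c : nat -> R, x = \sum_(i < size s) c i * s`_i.

Lemma in_span0 s : in_span s 0.
Proof. by exists (fun=> 0); rewrite big1 // => i _; rewrite mul0r. Qed.

Lemma in_spanMD s c x y : in_span s x -> in_span s y -> in_span s (c * x + y).
Proof.
case=> d -> [e ->]; exists (fun i => c * d i + e i).
rewrite mulr_sumr -big_split /=; apply: eq_bigr => i _.
by rewrite mulrA -mulrDl.
Qed.

Lemma in_span_sum s (J : Type) (r : seq J) (P : pred J) (F : J -> R) :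
  (forall j, P j -> in_span s (F j)) -> in_span s (\sum_(j <- r | P j) F j).
Proof.
move=> sF; apply: (@big_ind _ (in_span s)) => //; first exact: in_span0.
by move=> x y sx sy; rewrite -[x]mul1r; apply: in_spanMD.
Qed.

Lemma in_spanM s c x : in_span s x -> in_span s (c * x).
Proof.
by move=> sx; rewrite -[_ * _]addr0; apply: in_spanMD => //; apply: in_span0.
Qed.

Lemma in_span_mem s x : x \in s -> in_span s x.
Proof.
move=> /(nthP 0)[k ltk <-]; exists (fun i => (i == k)%:R).
rewrite (bigD1 (Ordinal ltk)) //= eqxx mul1r big1 ?addr0 // => i.
by rewrite -val_eqE /= => /negPf->; rewrite mul0r.
Qed.

Lemma in_span_trans s t x :
  (forall y, y \in s -> in_span t y) -> in_span s x -> in_span t x.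
Proof.
move=> st [c ->]; apply: in_span_sum => i _; apply: in_spanM.
by apply: st; rewrite mem_nth.
Qed.

Lemma in_span_ideal s I x : submod_closed I ->
  (forall y, y \in s -> y \in I) -> in_span s x -> x \in I.
Proof.
move=> [I0 Ilin] sI [c ->]; elim/big_ind: _ => // [y z yI zI|i _].
  by have := Ilin 1 y z yI zI; rewrite scale1r.
have := Ilin (c i) _ 0 (sI _ (mem_nth 0 (ltn_ord i))) I0.
by rewrite addr0.
Qed.

Lemma generatesP s I : submod_closed I -> generates s I <->
  (forall y, y \in s -> y \in I) /\ (forall x, x \in I -> in_span s x).
Proof.
move=> Isub; split=> [sI|[sI Is] x]; last first.
  by split=> [/Is|]; last exact: in_span_ideal.
by split=> [y /in_span_mem/sI|x /sI].
Qed.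

End Generators.

Section Localization.
Variables (A : comNzRingType) (L : fieldType) (psi : {rmorphism A -> fps L}).

(** The localization is realized inside L[[t]], as the fractions [psi a / psi b] with [psi b] of
    nonzero constant term, written without division. As a subring of a domain it is a domain, and
    the order in t restricts to it. *)
Definition loc_pred : {pred fps L} :=
  [pred s | `[< exists a b, psi b 0%N != 0 /\ s * psi b = psi a >]].

Lemma loc_subring_closed : subring_closed loc_pred.
Proof.
split; first by apply/asboolP; exists 1, 1; rewrite rmorph1 oner_neq0 mul1r.
- move=> s s' /asboolP[a [b [b0 sb]]] /asboolP[a' [b' [b0' sb']]].
  apply/asboolP; exists (a * b' - a' * b), (b * b').
  split; first by rewrite rmorphM fps_coef0M mulf_neq0.
  by rewrite rmorphB !rmorphM -sb -sb'; ring.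
- move=> s s' /asboolP[a [b [b0 sb]]] /asboolP[a' [b' [b0' sb']]].
  apply/asboolP; exists (a * a'), (b * b').
  split; first by rewrite rmorphM fps_coef0M mulf_neq0.
  by rewrite !rmorphM -sb -sb'; ring.
Qed.

HB.instance Definition _ :=
  GRing.isSubringClosed.Build (fps L) loc_pred loc_subring_closed.

Record loc := Loc { loc_val : fps L; loc_valP : loc_val \in loc_pred }.

HB.instance Definition _ := [isSub for loc_val].
HB.instance Definition _ := [Choice of loc by <:].
HB.instance Definition _ := [SubChoice_isSubComNzRing of loc by <:].

Definition loc_unit : {pred loc} := [pred r | loc_val r 0%N != 0].

Lemma loc_inv_exists r : r \in loc_unit -> exists r', r' * r = 1.
Proof.
case: r => s sP; have /asboolP[a [b [b0 sb]]] := sP; rewrite inE /= => s0.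
have [t st] := fps_inv_exists s0.
have tP : t \in loc_pred.
  apply/asboolP; exists b, a; rewrite -sb fps_coef0M mulf_neq0 //.
  by rewrite mulrCA mulrA st mul1r.
by exists (Loc tP); apply/val_inj; rewrite /= mulrC.
Qed.

Definition loc_inv (r : loc) : loc :=
  if pselect (exists r', r' * r = 1) is left ex then sval (cid ex) else r.

Lemma loc_mulVr : {in loc_unit, left_inverse 1 loc_inv *%R}.
Proof.
move=> r /loc_inv_exists rU; rewrite /loc_inv.
by case: pselect => // ex; case: cid.
Qed.

Lemma loc_unitPl r r' : r' * r = 1 -> r \in loc_unit.
Proof.
move=> rr; rewrite inE; apply/eqP => r0.
have /fpsP/(_ 0%N)/eqP : loc_val r' * loc_val r = 1 := congr1 loc_val rr.
by rewrite fps_coef0M r0 mulr0 eq_sym oner_eq0.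
Qed.

Lemma loc_inv_out : {in [predC loc_unit], loc_inv =1 id}.
Proof.
move=> r; rewrite inE /= => rN; rewrite /loc_inv.
by case: pselect => // -[r' rr]; rewrite (loc_unitPl rr) in rN.
Qed.

HB.instance Definition _ := GRing.ComNzRing_hasMulInverse.Build loc
  loc_mulVr loc_unitPl loc_inv_out.

Lemma loc_mulf_eq0 : GRing.integral_domain_axiom loc.
Proof.
move=> r r' /(congr1 loc_val)/fps_mulf_eq0.
by rewrite -!(inj_eq val_inj).
Qed.

HB.instance Definition _ :=
  GRing.ComUnitRing_isIntegral.Build loc loc_mulf_eq0.

Lemma loc_valD (r r' : loc) n :
  loc_val (r + r') n = loc_val r n + loc_val r' n.
Proof. by []. Qed.

Lemma loc_valM (r r' : loc) : loc_val (r * r') = loc_val r * loc_val r'.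
Proof. by []. Qed.

Lemma loc_val_eq0 (r : loc) : (loc_val r == 0) = (r == 0).
Proof. by rewrite -(inj_eq val_inj). Qed.

Fact to_loc_subproof a : psi a \in loc_pred.
Proof.
by apply/asboolP; exists a, 1; rewrite rmorph1 oner_neq0 mulr1.
Qed.

Definition to_loc a : loc := Loc (to_loc_subproof a).

Lemma to_loc_is_zmod_morphism : zmod_morphism to_loc.
Proof. by move=> a b; apply/val_inj; rewrite /= rmorphB. Qed.

Lemma to_loc_is_monoid_morphism : monoid_morphism to_loc.
Proof.
by split=> [|a b]; apply/val_inj; rewrite /= ?rmorph1 ?rmorphM.
Qed.

HB.instance Definition _ :=
  GRing.isZmodMorphism.Build A loc to_loc to_loc_is_zmod_morphism.
HB.instance Definition _ :=
  GRing.isMonoidMorphism.Build A loc to_loc to_loc_is_monoid_morphism.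

Lemma to_loc_unit a : (to_loc a \is a GRing.unit) = (psi a 0%N != 0).
Proof. by []. Qed.

Lemma loc_fracP (r : loc) :
  exists a b, psi b 0%N != 0 /\ r * to_loc b = to_loc a.
Proof.
case: r => s sP; have /asboolP[a [b [b0 sb]]] := sP; exists a, b; split=> //.
exact/val_inj.
Qed.

Definition loc_max : {pred loc} := [pred r | loc_val r 0%N == 0].

Lemma loc_max_idealr_closed : idealr_closed loc_max.
Proof.
split=> [||c r r']; rewrite !inE ?eqxx //; first exact: oner_neq0.
rewrite loc_valD loc_valM fps_coef0M => /eqP-> /eqP->.
by rewrite mulr0 addr0.
Qed.

(** Every element outside [loc_max] is a unit, and a unit in J would put 1 into J. *)
Lemma idealr_sub_loc_max (J : {pred loc}) :
  idealr_closed J -> {subset J <= loc_max}.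
Proof.
case=> J0 J1 Jlin r rJ; rewrite inE; apply: contraNT J1 => r0.
by rewrite -[1]addr0 -[1](@mulVr _ r) // Jlin.
Qed.

Lemma loc_local_ring : local_ring loc_max.
Proof.
have maxm : maximal_ideal loc_max.
  split=> [|J Jid mJ r]; first exact: loc_max_idealr_closed.
  by apply/idP/idP => [/(idealr_sub_loc_max Jid) | /mJ].
split=> // m' [m'id m'max] r.
by rewrite -(m'max _ loc_max_idealr_closed) //; apply: idealr_sub_loc_max.
Qed.

(** Generators of the contraction of I to A also generate I, since each element of I is a unit
    multiple of the image of its numerator. *)
Lemma loc_noetherian : noetherian A -> noetherian loc.
Proof.
move=> nA I [I0 Ilin].
have IM c r : r \in I -> c * r \in I.
  by move=> rI; have := Ilin c r 0 rI I0; rewrite addr0.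
have ID r r' : r \in I -> r' \in I -> r + r' \in I.
  by move=> rI rI'; have := Ilin 1 r r' rI rI'; rewrite scale1r.
pose J : {pred A^o} := [pred a | to_loc a \in I].
have Jsub : submod_closed J.
  split=> [|c a b]; rewrite !inE ?rmorph0 // => aJ bJ.
  have -> : to_loc (c *: a + b) = to_loc c * to_loc a + to_loc b.
    by rewrite -rmorphM -rmorphD.
  by rewrite ID ?IM.
have [s /generatesP-/(_ Jsub)[sJ Js]] := nA J Jsub.
exists (map to_loc s); apply/generatesP => //.
split=> [_ /mapP[a /sJ aJ ->] // | r rI].
have [a [b [b0 rb]]] := loc_fracP r.
have bU : to_loc b \is a GRing.unit by rewrite to_loc_unit.
have /Js[c ac] : a \in J by rewrite inE -rb mulrC IM.
rewrite -[r](mulrK bU) rb mulrC ac rmorph_sum; apply/in_spanM/in_span_sum.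
by move=> i _; rewrite rmorphM; apply/in_spanM/in_span_mem/map_f/mem_nth.
Qed.

End Localization.

(** * Extension of a valuation to the fraction field *)

Lemma fraction_exists (R : idomainType) (x : {fraction R}) :
  exists p : R * R, p.2 != 0 /\ x = tofrac p.1 / tofrac p.2.
Proof.
elim/quotW: x => r; have d0 := denom_ratioP r.
exists (val r); split=> //; have dF0 : tofrac (val r).2 != 0.
  by rewrite tofrac_eq0.
apply: (mulIf dF0); rewrite divfK //; unlock FracField.tofrac.
rewrite -[LHS]FracField.pi_mul; apply/eqmodP; rewrite /= FracField.equivfE.
rewrite /FracField.mulf !numden_Ratio ?(mulf_neq0, oner_neq0) //.
by rewrite !mulr1 mulrC.
Qed.

Section ExtendValuation.
Variables (R : idomainType) (v : R -> nat).
Hypothesis vM : forall f g, f != 0 -> g != 0 -> v (f * g) = (v f + v g)%N.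
Hypothesis vD : forall f g, f != 0 -> g != 0 -> f + g != 0 ->
  (minn (v f) (v g) <= v (f + g)%R)%N.
Hypothesis v_uniformizer : exists2 f, f != 0 & v f = 1%N.

Definition frac_val (x : {fraction R}) : int :=
  let p := sval (cid (fraction_exists x)) in (v p.1)%:Z - (v p.2)%:Z.

(** Independence of the chosen representation: [f * b = a * g] gives [v f + v b = v a + v g]. *)
Lemma frac_valE f g : f != 0 -> g != 0 ->
  frac_val (tofrac f / tofrac g) = (v f)%:Z - (v g)%:Z.
Proof.
move=> f0 g0; rewrite /frac_val; case: cid => -[a b] /= [b0 fgE].
have fbag : f * b = a * g.
  apply/eqP; rewrite -tofrac_eq !tofracM; apply/eqP.
  have gF0 : tofrac g != 0 by rewrite tofrac_eq0.
  have bF0 : tofrac b != 0 by rewrite tofrac_eq0.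
  by rewrite -[tofrac f](divfK gF0) fgE mulrAC divfK.
have a0 : a != 0.
  by apply: contraNneq (mulf_neq0 f0 b0) => a0; rewrite fbag a0 mul0r.
by have := congr1 v fbag; rewrite !vM //; lia.
Qed.

Lemma fraction_neq0 (x : {fraction R}) : x != 0 ->
  exists f g, [/\ f != 0, g != 0 & x = tofrac f / tofrac g].
Proof.
have [[f g] /= [g0 ->]] := fraction_exists x => fg0.
by exists f, g; split=> //; apply: contraNneq fg0 => ->; rewrite tofrac0 mul0r.
Qed.

Lemma frac_valM x y :
  x != 0 -> y != 0 -> frac_val (x * y) = frac_val x + frac_val y.
Proof.
move=> /fraction_neq0[f [g [f0 g0 ->]]] /fraction_neq0[f' [g' [f0' g0' ->]]].
rewrite mulrACA -invfM -!tofracM !frac_valE ?mulf_neq0 // !vM //; lia.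
Qed.

Lemma frac_valD x y : x != 0 -> y != 0 -> x + y != 0 ->
  Num.min (frac_val x) (frac_val y) <= frac_val (x + y).
Proof.
move=> /fraction_neq0[f [g [f0 g0 ->]]] /fraction_neq0[f' [g' [f0' g0' ->]]].
rewrite addf_div ?tofrac_eq0 // -!tofracM -tofracD => s0.
have fgs0 : f * g' + f' * g != 0.
  by apply: contraNneq s0 => ->; rewrite tofrac0 mul0r.
rewrite !frac_valE ?mulf_neq0 //.
have := vD (mulf_neq0 f0 g0') (mulf_neq0 f0' g0) fgs0.
rewrite !vM // ge_min.
by move: (v (_ + _)%R) (v f) (v g) (v f') (v g') => w a b c d; lia.
Qed.

Lemma frac_val_surj (z : int) : exists2 x, x != 0 & frac_val x = z.
Proof.
have [p p0 vp] := v_uniformizer.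
have vX n : v (p ^+ n) = n.
  elim: n => [|n IHn]; last by rewrite exprS vM ?expf_neq0 // vp IHn.
  rewrite expr0; have := vM (oner_neq0 R) (oner_neq0 R).
  by rewrite mulr1; move: (v 1) => k; lia.
exists (tofrac (p ^+ `|Num.max z 0|%N) / tofrac (p ^+ `|Num.max (- z) 0|%N)).
  by rewrite mulf_neq0 ?invr_eq0 ?tofrac_eq0 ?expf_neq0.
rewrite frac_valE ?expf_neq0 // !vX; lia.
Qed.

Definition frac_valuation : discrete_valuation {fraction R} :=
  DiscreteValuation frac_valM frac_valD frac_val_surj.

Lemma frac_valuationE f : f != 0 -> frac_valuation (tofrac f) = v f :> int.
Proof.
move=> f0; rewrite -[tofrac f]divr1 -tofrac1 /= frac_valE ?oner_neq0 //.
by have := vM (oner_neq0 R) (oner_neq0 R); rewrite mulr1; move: (v 1) => k; lia.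
Qed.

End ExtendValuation.

(** * The order in t as a valuation dominating the localization *)

Section LocalizationValuation.
Variables (A : comNzRingType) (L : fieldType) (psi : {rmorphism A -> fps L}).
Variable (t : loc psi).
Hypothesis t_ord : fps_ord (loc_val t) = 1%N.

Let v (r : loc psi) : nat := fps_ord (loc_val r).

Lemma loc_ordM f g : f != 0 -> g != 0 -> v (f * g) = (v f + v g)%N.
Proof. by rewrite -!loc_val_eq0; apply: fps_ordM. Qed.

Lemma loc_ordD f g : f != 0 -> g != 0 -> f + g != 0 ->
  (minn (v f) (v g) <= v (f + g)%R)%N.
Proof. by rewrite -!loc_val_eq0; apply: fps_ordD. Qed.

Lemma fps_ord0 : fps_ord (0 : fps L) = 0%N.
Proof. by rewrite /fps_ord; case: pselect => // -[n]; rewrite eqxx. Qed.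

Lemma loc_ord_uniformizer : exists2 f : loc psi, f != 0 & v f = 1%N.
Proof.
exists t; rewrite // -loc_val_eq0.
(* The zero series has the default order 0, so order 1 forces [t] to be nonzero. *)
by apply: contra_eq_neq t_ord => ->; rewrite fps_ord0.
Qed.

Definition loc_valuation : discrete_valuation {fraction loc psi} :=
  frac_valuation loc_ordM loc_ordD loc_ord_uniformizer.

Lemma loc_valuationE (r : loc psi) :
  r != 0 -> loc_valuation (tofrac r) = fps_ord (loc_val r) :> int.
Proof. exact: frac_valuationE. Qed.

Lemma loc_valuation_ge n (r : loc psi) :
  (tofrac r \in val_ge loc_valuation (Posz n)) <->
  (forall i, (i < n)%N -> loc_val r i = 0).
Proof.
rewrite inE tofrac_eq0; have [->|r0] := eqVneq r 0; first by split.
by rewrite (loc_valuationE r0) lez_nat; apply: fps_ord_ge; rewrite loc_val_eq0.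
Qed.

Lemma loc_dominates : dominates (@loc_max A L psi) loc_valuation.
Proof.
split=> f; first exact/(loc_valuation_ge 0).
rewrite !inE tofrac_eq0; have [->|f0] := eqVneq f 0; first by rewrite eqxx.
rewrite (loc_valuationE f0) ltz_nat /=; apply/idP/eqP => [v0|fv0].
  have /fps_ord_ge : loc_val f != 0 by rewrite loc_val_eq0.
  by move=> /(_ 1%N)[/(_ v0)-> ].
by apply/fps_ord_ge => [|[]//]; rewrite loc_val_eq0.
Qed.

End LocalizationValuation.

(** * Hilbert's basis theorem *)

Lemma field_noetherian (F : fieldType) : noetherian F.
Proof.
move=> I [I0 Ilin]; case: (pselect (exists2 a, a \in I & a != 0)) => [|none].
  move=> [a aI a0]; exists [:: 1]; apply/generatesP; rewrite //; split=> x.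
    rewrite inE => /eqP->; rewrite -(mulVf a0).
    by have := Ilin a^-1 a 0 aI I0; rewrite addr0.
  by move=> _; rewrite -[x]mulr1; apply/in_spanM/in_span_mem; rewrite inE.
exists [::]; apply/generatesP; rewrite //; split=> // x xI.
have [->|x0] := eqVneq x 0; first exact: in_span0.
by case: none; exists x.
Qed.

Section HilbertBasis.
Variables (R : comNzRingType) (nR : noetherian R).
Variables (I : {pred {poly R}^o}) (Isub : submod_closed I).

Definition coef_ideal d : {pred R^o} :=
  [pred c : R | `[< exists g : {poly R}, [/\ g \in I, (size g <= d.+1)%N
                                           & g`_d = c] >]].

Let I0 : 0 \in I. Proof. by case: Isub. Qed.

Let IMD (c g h : {poly R}) : g \in I -> h \in I -> c * g + h \in I.
Proof. by case: Isub => _; apply. Qed.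

Let IM (c g : {poly R}) : g \in I -> c * g \in I.
Proof. by move=> gI; rewrite -[_ * _]addr0; apply: IMD. Qed.

Lemma coef_ideal_closed d : submod_closed (coef_ideal d).
Proof.
split=> [|c a b]; first by apply/asboolP; exists 0; rewrite size_poly0 coef0.
move=> /asboolP[g [gI sg <-]] /asboolP[h [hI sh <-]]; apply/asboolP.
exists (c%:P * g + h); split; first exact: IMD.
  rewrite (leq_trans (size_polyD _ _)) // geq_max sh andbT mul_polyC.
  exact: leq_trans (size_scale_leq _ _) sg.
by rewrite coefD coefCM.
Qed.

Lemma coef_ideal_le d e c : (d <= e)%N -> c \in coef_ideal d ->
  c \in coef_ideal e.
Proof.
move=> /subnKC <- /asboolP[g [gI sg <-]]; apply/asboolP.
exists ('X^(e - d) * g); split; first exact: IM.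
  have [->|g0] := eqVneq g 0; first by rewrite mulr0 size_poly0.
  by rewrite -commr_polyXn size_mulXn //; lia.
by rewrite -commr_polyXn coefMXn ltnNge leq_addl /= addnK.
Qed.

Lemma lift_coefs d (cs : seq R) :
    (forall c, c \in cs -> c \in coef_ideal d) ->
  exists gs : seq {poly R},
    [/\ forall g, g \in gs -> g \in I /\ (size g <= d.+1)%N
      & cs = [seq g`_d | g : {poly R} <- gs]].
Proof.
elim: cs => [|c cs IHcs] csd; first by exists [::].
have [|gs [gsI ->]] := IHcs.
  by move=> a acs; apply: csd; rewrite inE acs orbT.
have /asboolP[g [gI sg <-]] := csd c (mem_head _ _).
exists (g :: gs); split=> // h; rewrite inE => /predU1P[-> //|]; exact: gsI.
Qed.

(** The division step: the elements of [gs], multiplied by ['X^(d - n)], have their coefficient of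
    degree n moved to degree d, where a combination of them cancels that of f. *)
Lemma reduce_size n d (gs : seq {poly R}) (f : {poly R}) :
    (n <= d)%N -> (forall g, g \in gs -> g \in I /\ (size g <= n.+1)%N) ->
    f \in I -> (size f <= d.+1)%N ->
    in_span [seq g`_n | g : {poly R} <- gs] f`_d ->
  exists h, [/\ in_span gs h, f - h \in I & (size (f - h)%R <= d)%N].
Proof.
move=> lend gsI fI sf [c fd]; rewrite size_map in fd.
pose h := \sum_(i < size gs) (c i *: 'X^(d - n)) * gs`_i.
have gsP (i : 'I_(size gs)) : gs`_i \in I /\ (size (gs`_i)%R <= n.+1)%N.
  by apply/gsI/mem_nth.
exists h; split.
- by apply: in_span_sum => i _; apply/in_spanM/in_span_mem/mem_nth.
- rewrite -[f]mulr1 -mulN1r addrC mulr1; apply: IMD => //.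
  rewrite /h; elim/big_ind: _ => [//|x y xI yI|i _].
    by rewrite -[x]mul1r; apply: IMD.
  by apply: IM; case: (gsP i).
apply/leq_sizeP => j; rewrite leq_eqVlt => /predU1P[<-|ltdj].
  rewrite coefB fd coef_sum -sumrB big1 // => i _.
  rewrite (nth_map 0) // -scalerAl coefZ -commr_polyXn coefMXn ltnNge leq_subr.
  by rewrite /= subKn // subrr.
rewrite coefB (leq_sizeP _ _ sf) // coef_sum big1 ?subr0 // => i _.
rewrite -scalerAl coefZ -commr_polyXn coefMXn.
case: ifP => _; rewrite ?mulr0 // (leq_sizeP _ _ (gsP i).2) ?mulr0 //; lia.
Qed.

(** Induction on the size: lifts of generators of [coef_ideal n] reduce an element of size n + 1 to
    one of size at most n. *)
Lemma bounded_size_span n : exists s : seq {poly R},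
  (forall g, g \in s -> g \in I) /\
  (forall f, f \in I -> (size f <= n)%N -> in_span s f).
Proof.
elim: n => [|n [s [sI Is]]].
  exists [::]; split=> // f _; rewrite leqn0 size_poly_eq0 => /eqP->.
  exact: in_span0.
have [cs] := nR (coef_ideal_closed n).
move/generatesP => /(_ (coef_ideal_closed n)) [csI Ics].
have [gs [gsI csE]] := lift_coefs csI.
exists (s ++ gs); split=> [g|f fI sf].
  by rewrite mem_cat => /orP[/sI // | /gsI[]].
have [|h [gsh fhI sfh]] := reduce_size (leqnn n) gsI fI sf.
  by rewrite -csE; apply: Ics; apply/asboolP; exists f.
rewrite -(subrK h f) -[f - h]mul1r; apply: in_spanMD.
  apply: in_span_trans (Is _ fhI sfh) => g gs'.
  by apply: in_span_mem; rewrite mem_cat gs'.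
apply: in_span_trans gsh => g gs'.
by apply: in_span_mem; rewrite mem_cat gs' orbT.
Qed.

Definition all_coef_ideal : {pred R^o} :=
  [pred c : R | `[< exists d, c \in coef_ideal d >]].

Lemma all_coef_ideal_closed : submod_closed all_coef_ideal.
Proof.
split=> [|c a b].
  by apply/asboolP; exists 0%N; case: (coef_ideal_closed 0).
move=> /asboolP[d ad] /asboolP[e be]; apply/asboolP; exists (maxn d e).
have [_ lin] := coef_ideal_closed (maxn d e).
by apply: lin; [apply: coef_ideal_le ad | apply: coef_ideal_le be]; lia.
Qed.

(** Generators of the ideal of all leading coefficients lift to elements [gs] in one common degree
    n. These lower the size of any element of size above n; the remaining ones are spanned by the
    finite family of [bounded_size_span]. *)
Lemma hilbert_basis_ideal : exists s, generates s I.
Proof.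
have [cs] := nR all_coef_ideal_closed.
move/generatesP => /(_ all_coef_ideal_closed)[csI Ics].
have [n csn] : exists n, forall c, c \in cs -> c \in coef_ideal n.
  elim: cs csI {Ics} => [|c cs IHcs] csI; first by exists 0%N.
  have [|n csn] := IHcs.
    by move=> a acs; apply: csI; rewrite inE acs orbT.
  have /asboolP[d cd] := csI c (mem_head _ _).
  exists (maxn d n) => a; rewrite inE => /predU1P[->|/csn an].
    by apply: coef_ideal_le cd; apply: leq_maxl.
  by apply: coef_ideal_le an; apply: leq_maxr.
have [gs [gsI csE]] := lift_coefs csn.
have [s [sI Is]] := bounded_size_span n.
exists (s ++ gs); apply/generatesP => //; split=> [g|f].
  by rewrite mem_cat => /orP[/sI // | /gsI[]].
have [d] := ubnP (size f); elim: d f => // d IHd f; rewrite ltnS => sf fI.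
have [le_sn|lt_ns] := leqP (size f) n.
  apply: in_span_trans (Is _ fI le_sn) => g gs'.
  by apply: in_span_mem; rewrite mem_cat gs'.
have [k fk] : exists k, size f = k.+1.
  by case: (size f) lt_ns => // k _; exists k.
have le_nk : (n <= k)%N by rewrite -ltnS -fk.
have [||h [gsh fhI sfh]] := reduce_size le_nk gsI fI; first by rewrite fk.
  rewrite -csE; apply: Ics; apply/asboolP; exists k.
  by apply/asboolP; exists f; rewrite fk.
rewrite -(subrK h f) -[f - h]mul1r; apply: in_spanMD.
  by apply: IHd => //; apply: leq_trans sf; rewrite fk.
apply: in_span_trans gsh => g gs'.
by apply: in_span_mem; rewrite mem_cat gs' orbT.
Qed.

End HilbertBasis.

Lemma hilbert_basis (R : comNzRingType) : noetherian R -> noetherian {poly R}.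
Proof. by move=> nR I Isub; apply: hilbert_basis_ideal. Qed.

(** * The plane localized at the origin *)

Section ProperIdeals.
Variables (R : comNzRingType) (Q : {pred R}) (Qid : idealr_closed Q).

Lemma idealr_0 : 0 \in Q. Proof. by case: Qid. Qed.

Lemma idealr_1 : 1 \notin Q. Proof. by case: Qid. Qed.

Lemma idealrM c u : u \in Q -> c * u \in Q.
Proof.
by case: Qid => Q0 _ Qlin uQ; rewrite -[_ * _]addr0; apply: Qlin.
Qed.

Lemma idealrD u v : u \in Q -> v \in Q -> u + v \in Q.
Proof. by case: Qid => _ _ Qlin uQ vQ; rewrite -[u]mul1r; apply: Qlin. Qed.

Lemma prime_idealrX u n : prime_idealr_closed Q -> u ^+ n \in Q -> u \in Q.
Proof.
move=> Qpr; elim: n => [|n IHn]; first by rewrite expr0 (negPf idealr_1).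
by rewrite exprS => /Qpr/orP[].
Qed.

End ProperIdeals.

Section PrimesOfPlane.
Variable k : fieldType.
(** In k[X][Y] the inner variable X is ['X%:P] and the outer variable Y is ['X]. *)
Local Notation A := {poly {poly k}}.
Local Notation eval00 a := ((a : A).[0].[0]).

Lemma min_size (D : {pred A}) f : f \in D -> f != 0 -> exists g,
  [/\ g \in D, g != 0 & forall h, h \in D -> h != 0 -> (size g <= size h)%N].
Proof.
have [n] := ubnP (size f); elim: n f => // n IHn f; rewrite ltnS => sf fD f0.
case: (pselect (exists h, [/\ h \in D, h != 0 & (size h < size f)%N])).
  by case=> h [hD h0 shf]; apply: (IHn h) => //; apply: leq_trans shf sf.
move=> none; exists f; split=> // h hD h0; rewrite leqNgt.
by apply/negP => shf; apply: none; exists h.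
Qed.

(* If Q meets k[X] in 0 then, by pseudo-division, an element h of Q of minimal
   degree in Y divides every element of Q up to k[X]; comparing degrees, h lies
   in P, whence Q = P. *)
Lemma prime_above_meets_line (P Q : {pred A}) f g :
    prime_ideal P -> prime_ideal Q -> {subset P <= Q} ->
    f \in P -> f != 0 -> g \in Q -> g \notin P ->
  exists2 c : {poly k}, c != 0 & c%:P \in Q.
Proof.
move=> [Pid Ppr] [Qid Qpr] PQ fP f0 gQ gP; apply: contrapT => none.
have nzQ c : c != 0 -> c%:P \notin Q.
  by move=> c0; apply/negP => cQ; apply: none; exists c.
have [h [hQ h0 hmin]] := min_size (PQ _ fP) f0.
have sh : (1 < size h)%N.
  rewrite ltnNge; apply: contraL hQ => sh.
  rewrite (size1_polyC sh); apply: nzQ.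
  by apply: contra_neq h0 => e; rewrite (size1_polyC sh) e.
have divQ (a : A) : a \in Q ->
    exists (c : {poly k}) (q : A), c != 0 /\ c%:P * a = q * h.
  move=> aQ; exists (lead_coef h ^+ scalp a h), (a %/ h)%R.
  rewrite expf_neq0 ?lead_coef_eq0 //; split=> //.
  rewrite mul_polyC Pdiv.Idomain.divp_eq; set r := (a %% h)%R.
  suff -> : r = 0 by rewrite addr0.
  apply/eqP; apply: contraT => r0.
  have : r \in Q.
    have <- : lead_coef h ^+ scalp a h *: a - (a %/ h)%R * h = r.
      by rewrite Pdiv.Idomain.divp_eq addrAC subrr add0r.
    by rewrite -mul_polyC -mulNr idealrD ?idealrM.
  by move=> /hmin/(_ r0); rewrite leqNgt Pdiv.Idomain.ltn_modp h0.
have [p [pP p0 pmin]] := min_size fP f0.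
have [c [q [c0 cp]]] := divQ p (PQ _ pP).
have : q * h \in P by rewrite -cp idealrM.
have q0 : q != 0.
  apply: contra_eq_neq cp => ->; rewrite mul0r mulf_neq0 // polyC_eq0.
  exact: c0.
case/Ppr/orP => [qP | hP].
  have := pmin _ qP q0; rewrite -(size_Cmul p c0) cp size_mul //.
  by move: (size q) (size h) sh => m n; lia.
have [d [u [d0 du]]] := divQ g gQ.
have : d%:P * g \in P by rewrite du idealrM.
case/Ppr/orP => [dP|]; last by rewrite (negPf gP).
by have := nzQ d d0; rewrite PQ.
Qed.

(** Write [c] as u X^n with u(0) nonzero. Since Q vanishes at the origin it does not contain u, so
    it contains X^n and hence X. *)
Lemma prime_at_origin_has_X (Q : {pred A}) (c : {poly k}) :
    prime_ideal Q -> (forall a, a \in Q -> eval00 a = 0) ->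
  c != 0 -> c%:P \in Q -> 'X%:P \in Q.
Proof.
move=> [Qid Qpr] Q00 c0 cQ; have [n [u]] := multiplicity_XsubC c 0.
rewrite c0 subr0 /= => u0 cE; move: cQ; rewrite cE polyCM polyC_exp.
case/Qpr/orP => [/Q00 | /prime_idealrX]; last exact.
by rewrite hornerC => /eqP; rewrite -rootE (negPf u0).
Qed.

Lemma prime_ideal_preim (R S : comNzRingType) (f : {rmorphism R -> S})
  (Q : {pred S}) : prime_ideal Q -> prime_ideal [pred a | f a \in Q].
Proof.
move=> [Qid Qpr]; split=> [|u v]; last by rewrite !inE rmorphM => /Qpr.
split=> [||a u v]; rewrite !inE ?rmorph0 ?rmorph1 ?idealr_0 ?idealr_1 //.
by move=> uQ vQ; rewrite rmorphD rmorphM idealrD ?idealrM.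
Qed.

Lemma eval00_swap (a : A) : eval00 (swapXY a) = eval00 a.
Proof. by rewrite -[X in _.[X].[_]]polyC0 horner2_swapXY polyC0. Qed.

Lemma decomp_at_origin (a : A) :
  exists b (c : {poly k}), a = b * 'X + c%:P * 'X%:P + (eval00 a)%:P%:P.
Proof.
have /factor_theorem[b ab] : root (a - a.[0]%:P) 0.
  by rewrite rootE !hornerE subrr.
have /factor_theorem[c ac] : root (a.[0] - (eval00 a)%:P) 0.
  by rewrite rootE !hornerE subrr.
exists b, c; move: ab ac; rewrite !subr0 => /eqP; rewrite subr_eq => /eqP aE.
move/eqP; rewrite subr_eq => /eqP a0E.
by rewrite {1}aE {1}a0E polyCD polyCM addrA.
Qed.

(** A chain 0 < P < Q of primes at the origin forces Q to meet k[X] outside 0, hence to contain X.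
    Exchanging the variables gives Y, and X and Y generate the ideal of the origin. *)
Lemma prime_height_two (P Q : {pred A}) f g :
    prime_ideal P -> prime_ideal Q -> {subset P <= Q} ->
    f \in P -> f != 0 -> g \in Q -> g \notin P ->
    (forall a, a \in Q -> eval00 a = 0) ->
  forall a, eval00 a = 0 -> a \in Q.
Proof.
move=> Ppr Qpr PQ fP f0 gQ gP Q00 a a00.
have [c c0 cQ] := prime_above_meets_line Ppr Qpr PQ fP f0 gQ gP.
have xQ := prime_at_origin_has_X Qpr Q00 c0 cQ.
pose sw (S : {pred A}) : {pred A} := [pred b : A | swapXY b \in S].
have swpr (S : {pred A}) : prime_ideal S -> prime_ideal (sw S).
  exact: prime_ideal_preim.
have swK (S : {pred A}) (b : A) : (swapXY b \in sw S) = (b \in S).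
  by rewrite inE swapXYK.
have [d d0 dQ] : exists2 d : {poly k}, d != 0 & d%:P \in sw Q.
  apply: (@prime_above_meets_line (sw P) (sw Q) (swapXY f) (swapXY g)).
  - exact: swpr.
  - exact: swpr.
  - by move=> b; apply: PQ.
  - by rewrite swK.
  - by rewrite swapXY_eq0.
  - by rewrite swK.
  - by rewrite swK.
have yQ : 'X \in Q.
  rewrite -swapXY_Y -/(sw Q _); apply: (prime_at_origin_has_X _ _ d0 dQ).
    exact: swpr.
  by move=> b /Q00; rewrite eval00_swap.
have [Qid _] := Qpr; have [b [e ->]] := decomp_at_origin a.
by rewrite a00 !polyC0 addr0 idealrD ?idealrM.
Qed.

End PrimesOfPlane.

(** * Extension of prime ideals to the localization *)

Section LocalizationPrimes.
Variables (A : comNzRingType) (L : fieldType) (psi : {rmorphism A -> fps L}).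
Hypothesis psi_inj : injective psi.

Definition extend_ideal (Q : {pred A}) : {pred loc psi} :=
  [pred r | `[< exists a b, [/\ psi b 0%N != 0, a \in Q
                              & r * to_loc psi b = to_loc psi a] >]].

Lemma to_loc_inj : injective (to_loc psi).
Proof. by move=> a b /(congr1 (@loc_val _ _ _))/psi_inj. Qed.

Section OnePrime.
Variables (Q : {pred A}) (Qpr : prime_ideal Q).
Hypothesis Q00 : forall a, a \in Q -> psi a 0%N = 0.

(** A denominator has nonzero constant term, so it lies outside Q and primality cancels it. *)
Lemma to_loc_extend a : (to_loc psi a \in extend_ideal Q) = (a \in Q).
Proof.
have [Qid Qprime] := Qpr; apply/asboolP/idP => [[c [b [b0 cQ]]]|aQ].
  rewrite -rmorphM => /to_loc_inj abc; move: cQ; rewrite -abc.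
  by case/Qprime/orP => // /Q00 b00; rewrite b00 eqxx in b0.
by exists a, 1; rewrite !rmorph1 mulr1 oner_neq0.
Qed.

Lemma extend_prime_ideal : prime_ideal (extend_ideal Q).
Proof.
have [Qid Qprime] := Qpr; split; last first.
  move=> r r' /asboolP[a [b [b0 aQ rb]]].
  have [c [d [d0 rd]]] := loc_fracP r; have [c' [d' [d0' rd']]] := loc_fracP r'.
  have : c * c' * b \in Q.
    rewrite (_ : c * c' * b = d * d' * a) ?idealrM //.
    by apply: to_loc_inj; rewrite !rmorphM /= -rd -rd' -rb; ring.
  case/Qprime/orP => [|/Q00 b00]; last by rewrite b00 eqxx in b0.
  case/Qprime/orP => cQ; apply/orP; [left | right]; apply/asboolP.
    by exists c, d.
  by exists c', d'.
split; first by rewrite -(rmorph0 (to_loc psi)) to_loc_extend idealr_0.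
  by rewrite -(rmorph1 (to_loc psi)) to_loc_extend idealr_1.
move=> r u u' /asboolP[a [b [b0 aQ ub]]] /asboolP[a' [b' [b0' aQ' ub']]].
have [c [d [d0 rd]]] := loc_fracP r; apply/asboolP.
exists (c * b' * a + d * b * a'), (d * b * b'); split.
- by rewrite !rmorphM !fps_coef0M !mulf_neq0.
- by rewrite idealrD ?idealrM.
by rewrite rmorphD !rmorphM /= -rd -ub -ub'; ring.
Qed.

End OnePrime.

Lemma mem_loc_ideal (I : {pred loc psi}) r a b : idealr_closed I ->
    psi b 0%N != 0 -> r * to_loc psi b = to_loc psi a ->
  (to_loc psi a \in I) = (r \in I).
Proof.
move=> Iid b0 <-; apply/idP/idP => rI; last by rewrite mulrC idealrM.
by rewrite -(@mulrK _ (to_loc psi b) _ r) // mulrC idealrM.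
Qed.

End LocalizationPrimes.

(** * Dimension and regularity of the localized plane *)

Section RegularPlane.
Variables (k L : fieldType) (psi : {rmorphism {poly {poly k}} -> fps L}).
Hypothesis psi_inj : injective psi.
Hypothesis psi00 : forall a, (psi a 0%N == 0) = (a.[0].[0] == 0).

Lemma generates_loc_max :
  generates [:: to_loc psi 'X; to_loc psi 'X%:P] (@loc_max _ _ psi).
Proof.
have X00 : psi 'X 0%N == 0 by rewrite psi00 !hornerE.
have Y00 : psi 'X%:P 0%N == 0 by rewrite psi00 !hornerE.
have mid := @loc_max_idealr_closed _ _ psi.
apply/generatesP; last split=> [r|r].
- by case: mid => m0 _ mlin; split=> // a u v um vm; apply: mlin.
- by rewrite !inE => /orP[] /eqP->; [exact: X00 | exact: Y00].
have [a [b [b0 rb]]] := loc_fracP r; rewrite -(mem_loc_ideal mid b0 rb) inE.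
rewrite psi00 => /eqP a00; have [c [d aE]] := decomp_at_origin a.
rewrite -(@mulrK _ (to_loc psi b) _ r) // rb mulrC; apply: in_spanM.
rewrite aE a00 !polyC0 addr0 rmorphD !rmorphM; apply: in_spanMD.
  by apply: in_span_mem; rewrite mem_head.
by apply/in_spanM/in_span_mem; rewrite !inE eqxx orbT.
Qed.

Lemma prime_ideal_ker (R S : comNzRingType) (f : {rmorphism R -> S}) :
    (forall x y : S, x * y = 0 -> (x == 0) || (y == 0)) ->
  prime_ideal [pred a | f a == 0].
Proof.
move=> Sint; split=> [|u v]; last by rewrite !inE rmorphM => /eqP/Sint.
split=> [||a u v]; rewrite !inE ?rmorph0 ?rmorph1 ?eqxx ?oner_neq0 //.
by move=> /eqP uQ /eqP vQ; rewrite rmorphD rmorphM uQ vQ mulr0 addr0.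
Qed.

(** The chain 0 < (Y) < (X, Y), written as kernels of evaluations so that primality is immediate. *)
Definition flag (i : nat) : {pred {poly {poly k}}} :=
  [pred a | match i with 0 => a == 0 | 1 => a.[0] == 0
            | _ => a.[0].[0] == 0 end].

Lemma flag_prime i : prime_ideal (flag i).
Proof.
case: i => [|[|i]].
- by apply: (@prime_ideal_ker _ _ idfun) => x y /eqP; rewrite mulf_eq0.
- apply: (@prime_ideal_ker _ _ (horner_eval 0)) => x y /eqP.
  by rewrite mulf_eq0.
apply: (@prime_ideal_ker _ _
          (horner_eval (0 : k) \o horner_eval (0 : {poly k}))).
by move=> x y /eqP; rewrite mulf_eq0.
Qed.

Lemma krull_dim_plane : krull_dim (loc psi) 2.
Proof.
have flag00 i a : a \in flag i -> psi a 0%N = 0.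
  move=> ai; apply/eqP; rewrite psi00; move: ai.
  by case: i => [|[|i]] => /eqP // ->; rewrite ?horner0.
split.
  exists (fun i => @extend_ideal _ _ psi (flag i)); split=> i lti.
    by apply: extend_prime_ideal => //; [apply: flag_prime | apply: flag00].
  split=> [r /asboolP[a [b [b0 ai rb]]]|sub].
    apply/asboolP; exists a, b; split=> //; move: ai.
    by rewrite !inE; case: i lti => [|[|]] // _ /eqP->; rewrite ?horner0.
  (* Y separates the first two members of the flag, X the last two. *)
  pose a : {poly {poly k}} := if i == 0%N then 'X else 'X%:P.
  have /sub : to_loc psi a \in @extend_ideal _ _ psi (flag i.+1).
    rewrite to_loc_extend //; [|exact: flag_prime|exact: flag00].
    by case: i {sub} lti @a => [|[|]] //= _; rewrite inE !hornerE.
  rewrite to_loc_extend //; [|exact: flag_prime|exact: flag00].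
  by case: i {sub} lti @a => [|[|]] //= _;
    rewrite inE ?hornerE ?polyX_eq0.
(* Upper bound: in a chain of length at least 3 the contractions of [N 1] and [N 2] fall under
   [prime_height_two], so [N 2] contains everything that vanishes at the origin and leaves no room
   for [N 3]. *)
move=> l N [Npr Nlt]; rewrite leqNgt; apply/negP => l2.
have [N12 _] := Nlt 1%N (ltnW l2).
have Nid i : (i <= l)%N -> idealr_closed (N i) by move=> /Npr[].
have prC i : (i <= l)%N -> prime_ideal [pred a | to_loc psi a \in N i].
  by move=> /Npr; apply: prime_ideal_preim.
have wit i : (i < l)%N ->
    exists2 a, to_loc psi a \in N i.+1 & to_loc psi a \notin N i.
  move=> ltil; have [_ Nn] := Nlt i ltil.
  apply: contrapT => none; apply: Nn => r rN.
  have [a [b [b0 rb]]] := loc_fracP r.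
  rewrite -(mem_loc_ideal (Nid i (ltnW ltil)) b0 rb).
  apply: contrapT => /negP aN; apply: none; exists a => //.
  by rewrite (mem_loc_ideal (Nid _ ltil) b0 rb).
have [f fN1 fN0] := wit 0%N (ltnW (ltnW l2)).
have [g gN2 gN1] := wit 1%N (ltnW l2).
have [h hN3 hN2] := wit 2%N l2.
have l1 : (1 <= l)%N by lia.
have mQ a : a.[0].[0] = 0 -> to_loc psi a \in N 2.
  apply: (prime_height_two (prC 1%N l1) (prC 2 (ltnW l2)) _ fN1 _ gN2 gN1).
  - by move=> b; apply: N12.
  - by apply: contraNneq fN0 => ->; rewrite rmorph0 idealr_0 //; apply: Nid.
  move=> b bN; apply/eqP; rewrite -psi00.
  by have := idealr_sub_loc_max (Nid 2 (ltnW l2)) bN; rewrite inE.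
case/negP: hN2; apply: mQ; apply/eqP; rewrite -psi00.
by have := idealr_sub_loc_max (Nid 3 l2) hN3; rewrite inE.
Qed.

Lemma regular_local_plane : regular_local_ring (@loc_max _ _ psi) 2.
Proof.
split; last 1 first.
- exists [:: to_loc psi 'X; to_loc psi 'X%:P] => //.
  exact: generates_loc_max.
- exact/loc_noetherian/hilbert_basis/hilbert_basis/field_noetherian.
- exact: loc_local_ring.
exact: krull_dim_plane.
Qed.

End RegularPlane.

(** * The transcendental branch *)

Section Curve.
Variables (L : fieldType) (emb : {rmorphism 'F_2 -> L}) (a : nat -> L).
Local Notation A := {poly {poly 'F_2}}.

Definition tower_card i : nat := 2 ^ (2 ^ i).
(* gap i.+1 = gap i ^ 2 outgrows any affine function of gap i (injectivity of
   psi), and gap i = tower_card i.+1 ^ 2 (length at most sqrt n). *)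
Definition gap i : nat := tower_card i.+2.

Lemma tower_cardS i : tower_card i.+1 = (tower_card i ^ 2)%N.
Proof. by rewrite /tower_card expnS mulnC expnM. Qed.

Lemma tower_card_gt1 i : (1 < tower_card i)%N.
Proof. by rewrite -[1%N](expn0 2) ltn_exp2l ?expn_gt0. Qed.

Lemma ltn_tower_card i : (i < tower_card i)%N.
Proof. by apply: leq_trans (ltn_expl _ _) (ltnW (ltn_expl _ _)). Qed.

Lemma gap_gt i : (i < gap i)%N.
Proof. by rewrite (leq_trans _ (ltn_tower_card _)) // ltnW. Qed.

Lemma leq_tower_card i j : (i <= j)%N -> (tower_card i <= tower_card j)%N.
Proof. by move=> leij; rewrite /tower_card !leq_exp2l. Qed.

Lemma leq_gap i j : (i <= j)%N -> (gap i <= gap j)%N.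
Proof. by move=> leij; apply: leq_tower_card; rewrite !ltnS. Qed.

Lemma ltn_gap i j : (i < j)%N -> (gap i < gap j)%N.
Proof. by move=> ltij; rewrite /gap /tower_card !ltn_exp2l. Qed.

Definition branch j : {poly L} := \sum_(i < j) a i *: 'X^(gap i).

Lemma branchS j : branch j.+1 = branch j + a j *: 'X^(gap j).
Proof. exact: big_ord_recr. Qed.

Lemma coef_branch j l i :
  (j <= l)%N -> (i < gap j)%N -> (branch l)`_i = (branch j)`_i.
Proof.
move=> /subnKC <- ij; elim: (l - j)%N => [|n IHn]; first by rewrite addn0.
rewrite addnS branchS coefD IHn coefZ coefXn ltn_eqF ?mulr0 ?addr0 //.
by apply: leq_trans ij (leq_gap (leq_addr _ _)).
Qed.

Lemma size_branch j : (size (branch j.+1) <= (gap j).+1)%N.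
Proof.
elim: j => [|j IHj]; rewrite branchS (leq_trans (size_polyD _ _)) // geq_max.
  rewrite /branch big_ord0 size_poly0 /=.
  by rewrite (leq_trans (size_scale_leq _ _)) ?size_polyXn.
rewrite (leq_trans IHj) ?ltnS ?leq_gap //=.
by rewrite (leq_trans (size_scale_leq _ _)) ?size_polyXn.
Qed.

Lemma coef_branch_ge j i : (gap j <= i)%N -> (branch j)`_i = 0.
Proof.
case: j => [|j] ji; first by rewrite /branch big_ord0 coef0.
apply: (leq_sizeP _ _ (size_branch j)).
by apply: leq_trans ji; apply: ltn_gap.
Qed.

Lemma coef_branch_gap j l : (j < l)%N -> (branch l)`_(gap j) = a j.
Proof.
move=> ltjl; rewrite (coef_branch ltjl) ?ltn_gap // branchS coefD.
by rewrite coef_branch_ge // add0r coefZ coefXn eqxx mulr1.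
Qed.

(** The substitution of t for X and of Z for Y, where t is the variable of [{poly L}]. *)
Definition eval_at (Z : {poly L}) (p : A) : {poly L} :=
  (map_poly (map_poly emb) p).[Z].

Lemma eval_at_is_zmod_morphism Z : zmod_morphism (eval_at Z).
Proof. by move=> p q; rewrite /eval_at rmorphB !hornerE. Qed.

Lemma eval_at_is_monoid_morphism Z : monoid_morphism (eval_at Z).
Proof. by split=> [|p q]; rewrite /eval_at ?rmorph1 ?rmorphM !hornerE. Qed.

HB.instance Definition _ Z := GRing.isZmodMorphism.Build A {poly L} (eval_at Z)
  (eval_at_is_zmod_morphism Z).
HB.instance Definition _ Z := GRing.isMonoidMorphism.Build A {poly L}
  (eval_at Z) (eval_at_is_monoid_morphism Z).

Lemma eval_atC Z c : eval_at Z c%:P = map_poly emb c.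
Proof. by rewrite /eval_at map_polyC hornerC. Qed.

Lemma eval_atX Z : eval_at Z 'X = Z.
Proof. by rewrite /eval_at map_polyX hornerX. Qed.

Lemma eval_at_congr n (Z Z' : {poly L}) p :
    (forall i, (i < n)%N -> Z`_i = Z'`_i) ->
  forall i, (i < n)%N -> (eval_at Z p)`_i = (eval_at Z' p)`_i.
Proof.
move=> ZZ'; elim/poly_ind: p => [|p c IHp] i ltin; first by rewrite !rmorph0.
rewrite !rmorphD !rmorphM /= !eval_atC !eval_atX !coefD; congr (_ + _).
by apply: coef_polyM_congr => m lemi; [apply: IHp|apply: ZZ'];
  apply: leq_ltn_trans ltin.
Qed.

(** The image of p under X -> t, Y -> y. The series y itself is not formed: since [n < gap n], its
    truncation [branch n] already determines the coefficient of degree n. *)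
Definition psi (p : A) : fps L := fun n => (eval_at (branch n) p)`_n.

Lemma psi_coef j n p : (n < gap j)%N -> psi p n = (eval_at (branch j) p)`_n.
Proof.
move=> ltnj; have [lejn|ltjn] := leqP j n.
  by apply: (@eval_at_congr (gap j)) => // i ltij; apply: coef_branch.
apply: (@eval_at_congr (gap n)) (gap_gt n) => i ltin.
by rewrite (coef_branch (ltnW ltjn)).
Qed.

Lemma psi_is_zmod_morphism : zmod_morphism psi.
Proof. by move=> p q; apply/fpsP => n; rewrite /psi rmorphB coefB. Qed.

Lemma psi_is_monoid_morphism : monoid_morphism psi.
Proof.
split=> [|p q]; apply/fpsP => n; first by rewrite /psi rmorph1 coef1.
rewrite fps_coefM {1}/psi rmorphM coefM; apply: eq_bigr => i _.
by congr (_ * _); apply/esym/psi_coef; apply: leq_ltn_trans (gap_gt n);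
  rewrite ?leq_subr // -ltnS.
Qed.

HB.instance Definition _ :=
  GRing.isZmodMorphism.Build A (fps L) psi psi_is_zmod_morphism.
HB.instance Definition _ :=
  GRing.isMonoidMorphism.Build A (fps L) psi psi_is_monoid_morphism.

Lemma psi_coef0 p : psi p 0%N = emb p.[0].[0].
Proof.
rewrite /psi /branch big_ord0 /eval_at -(rmorph0 (map_poly emb)) horner_map.
by rewrite coef_map -horner_coef0.
Qed.

Lemma psi_eq00 p : (psi p 0%N == 0) = (p.[0].[0] == 0).
Proof. by rewrite psi_coef0 fmorph_eq0. Qed.

Lemma psi_X n : psi 'X%:P n = (n == 1)%:R.
Proof. by rewrite /psi eval_atC map_polyX coefX. Qed.

Lemma size_eval_at D M (Z : {poly L}) (p : A) :
    (forall i, (size (p`_i)%R <= D)%N) -> (size Z <= M.+1)%N ->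
  (size (eval_at Z p) <= D + size p * M)%N.
Proof.
move=> sD sZ; rewrite /eval_at horner_coef.
have sp : (size (map_poly (map_poly emb) p) <= size p)%N by apply: size_poly.
rewrite (leq_trans (size_sum _ _ _)) //; apply/bigmax_leqP => i _.
rewrite (leq_trans (size_polyMleq _ _)) // coef_map.
have si : (size (map_poly emb p`_i) <= D)%N.
  by rewrite (leq_trans (size_poly _ _)).
have sZi : (size (Z ^+ i)%R <= (size Z).-1 * i + 1)%N.
  by rewrite addn1 size_poly_exp_leq.
have iM : ((size Z).-1 * i <= size p * M)%N.
  rewrite mulnC leq_mul //; first by rewrite (leq_trans (ltnW (ltn_ord i))).
  by move: sZ; case: (size Z).
by move: si sZi iM => /=; move: (size _) (size (Z ^+ i)%R) => u w; lia.
Qed.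

(** If p is in the kernel, [eval_at (branch j.+1) p] vanishes below degree [gap j.+1], while its
    degree is bounded by an affine function of [gap j]. For large j it is therefore 0, which gives a
    nonzero p too many roots. *)
Lemma psi_inj : (forall i, a i != 0) -> injective psi.
Proof.
move=> a0; apply: raddf_inj => p p0; apply/eqP; apply: contraT => pn0.
pose D := (\max_(i < size p) size (p`_i)%R)%N.
have sD i : (size (p`_i)%R <= D)%N.
  have [lip|lepi] := ltnP i (size p); last by rewrite nth_default ?size_poly0.
  exact: (leq_bigmax (Ordinal lip)).
(* For [J <= j] one has [J <= gap j], so the size bound [D + size p * gap j] is at most [gap j ^ 2],
   which is [gap j.+1]. *)
pose J := (D + size p)%N.
have rootJ j : (J <= j)%N -> root (map_poly (map_poly emb) p) (branch j.+1).
  move=> Jj; rewrite rootE -/(eval_at _ _); apply/eqP/polyP => n.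
  rewrite coef0; have [ltn|len] := ltnP n (gap j.+1).
    by rewrite -psi_coef // p0.
  apply: (leq_sizeP _ _ (size_eval_at sD (size_branch j))).
  apply: leq_trans len.
  rewrite {2}/gap tower_cardS -/(gap j); have := gap_gt j.
  move: (gap j) => g gj; apply: (@leq_trans ((D + size p) * g)).
    by rewrite mulnDl leq_add2r leq_pmulr // (leq_ltn_trans _ gj).
  by rewrite -mulnn leq_mul2r (leq_trans Jj (ltnW gj)) orbT.
have mp0 : map_poly (map_poly emb) p != 0.
  by rewrite map_poly_eq0_id0 // map_poly_eq0 lead_coef_eq0.
(* These are [size p] roots, one more than the degree allows. They are distinct because the
   coefficient of degree [gap u.+1] is [a u.+1] in every branch beyond [u.+1] and 0 in
   [branch u.+1]. *)
pose rs := [seq branch j.+1 | j <- iota J (size p)].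
have rs_root : all (root (map_poly (map_poly emb) p)) rs.
  by apply/allP => u /mapP[j]; rewrite mem_iota => /andP[Jj _] ->; apply: rootJ.
have rs_uniq : uniq rs.
  rewrite map_inj_in_uniq ?iota_uniq // => i j _ _ bij.
  have nlt u v : branch u.+1 = branch v.+1 -> (v <= u)%N.
    move=> buv; rewrite leqNgt; apply/negP => ltuv; have := a0 u.+1.
    by rewrite -(@coef_branch_gap u.+1 v.+1) // -buv coef_branch_ge ?eqxx.
  by apply/eqP; rewrite eqn_leq !nlt.
have := max_poly_roots mp0 rs_root rs_uniq.
by rewrite size_map size_iota ltnNge size_poly.
Qed.

End Curve.

(** * Leading coefficients *)

Section Frobenius.
Variables (L : fieldType) (char2 : 2%N \in [pchar L]).

(* The phantom argument lets the ring morphism structure be inferred. *)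
Definition frob (_ : 2%N \in [pchar L]) (n : nat) (x : L) : L := x ^+ (2 ^ n).
Local Notation phi := (frob char2).

Lemma pnat_exp2 n : [pchar L].-nat (2 ^ n)%N.
Proof. by rewrite (eq_pnat _ (pcharf_eq char2)) pnatX pnat_id. Qed.

Lemma frob_is_zmod_morphism n : zmod_morphism (phi n).
Proof.
move=> x y; rewrite !(oppr_pchar2 char2) /frob.
by rewrite exprDn_pchar ?pnat_exp2.
Qed.

Lemma frob_is_monoid_morphism n : monoid_morphism (phi n).
Proof. by split=> [|x y]; rewrite /frob ?expr1n ?exprMn. Qed.

HB.instance Definition _ n := GRing.isZmodMorphism.Build L L (phi n)
  (frob_is_zmod_morphism n).
HB.instance Definition _ n := GRing.isMonoidMorphism.Build L L (phi n)
  (frob_is_monoid_morphism n).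

Lemma frob_add m n x : phi (m + n) x = phi n (phi m x).
Proof. by rewrite /frob -exprM -expnD. Qed.

Lemma map_frob_add m n (p : {poly L}) :
  map_poly (phi (m + n)) p = map_poly (phi n) (map_poly (phi m) p).
Proof. by apply/polyP => i; rewrite !coef_map /= frob_add. Qed.

Lemma map_frob0 (p : {poly L}) : map_poly (phi 0) p = p.
Proof. by apply/polyP => i; rewrite coef_map /= /frob expn0 expr1. Qed.

Lemma frob_F2 (emb : {rmorphism 'F_2 -> L}) n c : phi n (emb c) = emb c.
Proof.
have -> : emb c = (c : nat)%:R by rewrite -[c in LHS]natr_Zp rmorph_nat.
by rewrite rmorph_nat.
Qed.

Lemma frob1_fixed (emb : {rmorphism 'F_2 -> L}) x :
  phi 1 x = x -> x = emb (x != 0)%:R.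
Proof.
rewrite /frob expn1 => /eqP; rewrite -subr_eq0 expr2.
rewrite -{3}[x]mulr1 -mulrBr mulf_eq0 subr_eq0.
by case/orP => /eqP->; rewrite ?eqxx ?oner_neq0 ?rmorph0 ?rmorph1.
Qed.

(** K_i is the fixed field of an iterate of Frobenius, that is, the set of roots in L of x^q - x
    with q = [tower_card i]. *)
Definition tower_field (c : 2%N \in [pchar L]) i : {pred L} :=
  [pred x | frob c (2 ^ i) x == x].
Local Notation K := (tower_field char2).

Lemma tower_fieldE i x : (x \in K i) = (x ^+ tower_card i == x).
Proof. by []. Qed.

Lemma tower_field_le i j x : (i <= j)%N -> x \in K i -> x \in K j.
Proof.
move=> /subnKC <-; elim: (j - i)%N => [|n IHn] xi; first by rewrite addn0.
have /eqP xn := IHn xi.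
by rewrite inE addnS expnS mul2n -addnn frob_add !xn.
Qed.

Lemma tower_field0 i : 0 \in K i. Proof. by rewrite inE rmorph0. Qed.

Lemma tower_fieldD i x y : x \in K i -> y \in K i -> x + y \in K i.
Proof. by rewrite !inE rmorphD /= => /eqP-> /eqP->. Qed.

Lemma tower_fieldM i x y : x \in K i -> y \in K i -> x * y \in K i.
Proof. by rewrite !inE rmorphM /= => /eqP-> /eqP->. Qed.

Lemma tower_fieldV i x : x \in K i -> x^-1 \in K i.
Proof. by rewrite !inE fmorphV /= => /eqP->. Qed.

Lemma tower_field_F2 (emb : {rmorphism 'F_2 -> L}) i c : emb c \in K i.
Proof. by rewrite inE frob_F2. Qed.

Lemma coef_tower_field i (p : {poly L}) :
  map_poly (phi (2 ^ i)) p = p <-> (forall n, p`_n \in K i).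
Proof.
split=> [p_fix n|pK]; first by rewrite inE -{2}p_fix coef_map.
by apply/polyP => n; rewrite coef_map; apply/eqP/pK.
Qed.

Lemma card_tower_field i (s : seq L) :
  uniq s -> (forall x, x \in s -> x \in K i) -> (size s <= tower_card i)%N.
Proof.
move=> s_uniq sK.
have sz : size ('X^(tower_card i) - 'X : {poly L}) = (tower_card i).+1.
  rewrite size_polyDl ?size_polyXn // size_polyN size_polyX ltnS.
  exact: tower_card_gt1.
have /max_poly_roots/(_ _ s_uniq) : 'X^(tower_card i) - 'X != 0 :> {poly L}.
  by rewrite -size_poly_eq0 sz.
rewrite sz ltnS; apply; apply/allP => x /sK.
by rewrite tower_fieldE rootE !hornerE subr_eq0.
Qed.

End Frobenius.

Section LeadingCoefficients.
Variables (L : fieldType) (emb : {rmorphism 'F_2 -> L}) (a : nat -> L).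
Variable char2 : 2%N \in [pchar L].
(** An equation of Artin-Schreier type. With q = [tower_card i], the q-th power map moves [a i],
    which is thus outside K_i; applied twice it adds 1 + 1 = 0, so [a i] lies in K_(i+1). *)
Hypothesis aP : forall i, a i ^+ tower_card i = a i + 1.
Local Notation A := {poly {poly 'F_2}}.
Local Notation phi := (frob char2).
Local Notation K := (tower_field char2).
Local Notation y := (branch a).

Lemma tower_generator_notin i : a i \notin K i.
Proof. by rewrite tower_fieldE aP -subr_eq0 addrAC subrr add0r oner_neq0. Qed.

Lemma tower_generator_in i : a i \in K i.+1.
Proof.
rewrite tower_fieldE tower_cardS expnS expn1 exprM aP.
have -> : (a i + 1) ^+ tower_card i = phi (2 ^ i) (a i + 1) by [].
rewrite rmorphD rmorph1 /= (_ : frob _ _ _ = a i + 1); last exact: aP.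
by rewrite -addrA -mulr2n (pcharf0 char2) addr0.
Qed.

Lemma tower_generator_neq0 i : a i != 0.
Proof.
by apply: contraNneq (tower_generator_notin i) => ->; apply: tower_field0.
Qed.

Lemma branch_tower_field j : map_poly (phi (2 ^ j)) (y j) = y j.
Proof.
apply/coef_tower_field => n; rewrite coef_sum.
elim/big_ind: _ => [|u v uK vK|i _]; first exact: tower_field0.
  exact: tower_fieldD.
rewrite coefZ tower_fieldM //.
  exact: tower_field_le (ltn_ord i) (tower_generator_in i).
by rewrite coefXn inE rmorph_nat.
Qed.

(** The coefficients of p come from F_2 and are fixed by Frobenius, which therefore acts on Z
    alone. *)
Lemma map_frob_eval_at n Z (p : A) :
  map_poly (phi n) (eval_at emb Z p) = eval_at emb (map_poly (phi n) Z) p.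
Proof.
rewrite /eval_at -horner_map -map_poly_comp; congr (_.[_]).
apply: eq_map_poly => c /=; rewrite -map_poly_comp; apply: eq_map_poly => e /=.
exact: frob_F2.
Qed.

Lemma psi_tower_field j n (p : A) : (n < gap j)%N -> psi emb a p n \in K j.
Proof.
move=> /psi_coef->; move: (n); apply/coef_tower_field.
by rewrite map_frob_eval_at branch_tower_field.
Qed.

(** Write r as p / q. Its coefficient at n is that of [psi p] divided by the constant term of
    [psi q], an element of F_2. *)
Lemma loc_tower_field j n (r : loc (psi emb a)) :
    (n < gap j)%N -> (forall i, (i < n)%N -> loc_val r i = 0) ->
  loc_val r n \in K j.
Proof.
move=> ltnj rn; have [p [q [q0 rq]]] := loc_fracP r.
have : loc_val r * psi emb a q = psi emb a p := congr1 (@loc_val _ _ _) rq.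
move=> /fpsP/(_ n); have := (@fps_coefM_ord _ _ _ n 0 rn _).2.
rewrite addn0 => -> // rqn.
rewrite -[loc_val r n](mulfK q0) rqn tower_fieldM ?psi_tower_field //.
by rewrite tower_fieldV //= psi_coef0 tower_field_F2.
Qed.

(* The product of the conjugates of [Y - y j]; its Frobenius-fixed coefficients
   descend to F_2. *)
Lemma conjugate_product j r : map_poly (phi r) (y j) = y j ->
  exists p : A, forall Z : {poly L},
    eval_at emb Z p = \prod_(s < r) (Z - map_poly (phi s) (y j)).
Proof.
move=> yr; pose P := \prod_(s < r) ('X - (map_poly (phi s) (y j))%:P).
(* Frobenius shifts the factors cyclically: by [yr] the last one becomes the first. *)
have Pfix : map_poly (map_poly (phi 1)) P = P.
  rewrite rmorph_prod; transitivity
    (\prod_(s < r) ('X - (map_poly (phi s.+1) (y j))%:P)).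
    apply: eq_bigr => s _; rewrite rmorphB /= map_polyX map_polyC /=.
    by rewrite -map_frob_add addn1.
  case: r yr @P => [|r] yr P; rewrite {}/P; first by rewrite !big_ord0.
  by rewrite [LHS]big_ord_recr [RHS]big_ord_recl /= yr map_frob0 mulrC.
(* On the elements fixed by Frobenius, which are 0 and 1, this inverts [emb]. *)
pose down (x : L) : 'F_2 := (x != 0)%:R.
have down0 : down 0 = 0 by rewrite /down eqxx.
have downP0 : map_poly down 0 = 0 by rewrite map_poly0.
exists (map_poly (map_poly down) P) => Z.
have -> : \prod_(s < r) (Z - map_poly (phi s) (y j)) = P.[Z].
  by rewrite horner_prod; apply: eq_bigr => s _; rewrite !hornerE.
rewrite /eval_at; congr (_.[_]); apply/polyP => i; rewrite coef_map /=.
rewrite coef_map_id0 //; apply/polyP => n; rewrite coef_map /= coef_map_id0 //.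
apply/esym/(frob1_fixed (char2 := char2)).
by rewrite -{2}Pfix !coef_map.
Qed.

(** The term of lowest degree, not of highest degree as in [lead_coef]. *)
Definition lead (p : {poly L}) n c :=
  (forall i, (i < n)%N -> p`_i = 0) /\ p`_n = c.

Lemma leadM p q m n c d :
  lead p m c -> lead q n d -> lead (p * q) (m + n) (c * d).
Proof.
move=> [pm pc] [qn qd].
pose F (r : {poly L}) : fps L := fun i => r`_i.
have fpsE i : (p * q)`_i = (F p * F q) i by rewrite fps_coefM coefM.
have := @fps_coefM_ord L (F p) (F q) m n pm qn.
rewrite [F p m]pc [F q n]qd => -[z e]; split=> [i /z|]; by rewrite fpsE.
Qed.

Lemma poly_lead (p : {poly L}) : p != 0 ->
  exists n, [/\ (n < size p)%N, p`_n != 0 & forall i, (i < n)%N -> p`_i = 0].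
Proof.
move=> p0; have exn : exists n, p`_n != 0.
  by exists (size p).-1; rewrite -/(lead_coef p) lead_coef_eq0.
case: (ex_minnP exn) => n pn0 nmin; exists n; split=> // [|i ltin].
  by rewrite ltnNge; apply: contraNN pn0 => /leq_sizeP->.
by apply/eqP; apply: contraTT ltin => /nmin; rewrite -leqNgt.
Qed.

(** Neither [y j] nor its conjugate has terms of degree [gap j] or more. The lowest term of their
    difference thus lies below [gap j] and is unchanged when Z replaces [y j]. Both have
    coefficients in K_j. *)
Lemma conjugate_lead j s : map_poly (phi s) (y j) != y j ->
  exists n c, [/\ c \in K j, c != 0
    & forall Z : {poly L}, (forall i, (i < gap j)%N -> Z`_i = (y j)`_i) ->
        lead (Z - map_poly (phi s) (y j)) n c].
Proof.
move=> ysy; have [|n [sn dn0 dn]] := @poly_lead (y j - map_poly (phi s) (y j)).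
  by rewrite subr_eq0 eq_sym.
have ltn : (n < gap j)%N.
  rewrite ltnNge; apply: contraNN dn0 => jn.
  by rewrite coefB coef_map /= coef_branch_ge // rmorph0 subr0.
exists n, (y j - map_poly (phi s) (y j))`_n; split=> // [|Z Zy].
  move: (n); apply/coef_tower_field.
  by rewrite rmorphB /= -map_frob_add addnC map_frob_add branch_tower_field.
split=> [i ltin|]; last by rewrite !coefB Zy.
by have := dn i ltin; rewrite !coefB Zy // (ltn_trans ltin).
Qed.

(** In the product of the conjugates of Y - y_j, the factor Y - y_j has lowest coefficient [a j] and
    the others have theirs in K_j, so the product has lowest coefficient [a j * c] with c nonzero in
    K_j. *)
Lemma psi_new_coefficient j : exists (p : A) n,
  [/\ forall i, (i < n)%N -> psi emb a p i = 0, psi emb a p n \in K j.+1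
    & psi emb a p n \notin K j].
Proof.
have exr : exists r, (0 < r)%N && (map_poly (phi r) (y j) == y j).
  by exists (2 ^ j)%N; rewrite expn_gt0 branch_tower_field eqxx.
(* The least period of [y j] under Frobenius, named [r.+1]. By minimality the r conjugates other
   than [y j] differ from it, as [conjugate_lead] requires. *)
case: (ex_minnP exr) => -[//|r] /= /eqP yr rmin.
have [p pE] := conjugate_product yr.
have [n [c [cK c0 leadc]]] : exists n c, [/\ c \in K j, c != 0
    & forall Z : {poly L}, (forall i, (i < gap j)%N -> Z`_i = (y j)`_i) ->
        lead (\prod_(s < r) (Z - map_poly (phi s.+1) (y j))) n c].
  have: (r <= r)%N by []; elim: {-2}r => [|m IHm] ltmr.
    exists 0%N, 1; split; rewrite ?oner_neq0 //; first by rewrite inE rmorph1.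
    by move=> Z _; rewrite big_ord0; split; rewrite ?coef1.
  have [n [c [cK c0 leadc]]] := IHm (ltnW ltmr).
  have [|n' [c' [cK' c0' leadc']]] := @conjugate_lead j m.+1.
    by apply: contraTN ltmr => ym; rewrite -leqNgt -ltnS rmin.
  exists (n + n')%N, (c * c'); split; rewrite ?mulf_neq0 ?tower_fieldM //.
  move=> Z Zy; rewrite big_ord_recr.
  by apply: leadM; [apply: leadc | apply: leadc'].
have lead_p l : (j < l)%N -> lead (eval_at emb (y l) p) (gap j + n) (a j * c).
  move=> ltjl; rewrite pE big_ord_recl map_frob0; apply: leadM; last first.
    by apply: leadc => i; apply/coef_branch/ltnW.
  split=> [i ltij|]; rewrite coefB.
    by rewrite (@coef_branch _ _ j) ?subrr // ltnW.
  by rewrite coef_branch_gap // coef_branch_ge ?subr0.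
(* So large that [y l] contains the term of [a j] and determines [psi p] up to degree
   [gap j + n]. *)
pose l := maxn j.+1 (gap j + n); exists p, (gap j + n)%N.
have gapl i : (i <= gap j + n)%N -> (i < gap l)%N.
  by move=> lei; apply: leq_ltn_trans (leq_trans lei (leq_maxr _ _)) (gap_gt l).
have [z e] := lead_p l (leq_maxl _ _).
have pc : psi emb a p (gap j + n) = a j * c.
  by rewrite (@psi_coef _ _ _ l) ?gapl.
split; rewrite ?pc.
- by move=> i lti; rewrite (@psi_coef _ _ _ l) ?z // gapl // ltnW.
- rewrite tower_fieldM ?tower_generator_in //; exact: tower_field_le cK.
apply: contraNN (tower_generator_notin j) => acK.
by rewrite -[a j](mulfK c0) tower_fieldM ?tower_fieldV.
Qed.

End LeadingCoefficients.

(** * Length of a graded piece *)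

Lemma max_chain_length_exists (T : Type) (P : {pred T} -> Prop) c :
    (exists N, P N) -> (forall l N, strict_chain P l N -> (l <= c)%N) ->
  exists l, max_chain_length P l.
Proof.
move=> [N0 PN0] bounded; pose p l := `[< exists N, strict_chain P l N >].
have exp : exists l, p l by exists 0%N; apply/asboolP; exists (fun=> N0).
have leqp l : p l -> (l <= c)%N by move=> /asboolP[N]; apply: bounded.
case: (ex_maxnP exp leqp) => l /asboolP lN lmax; exists l; split=> // l' N lN'.
by apply: lmax; apply/asboolP; exists N.
Qed.

(** One element is picked from each difference of consecutive members, so a chain is no longer than
    the number of elements. *)
Lemma strict_chain_size (T : eqType) (P : {pred T} -> Prop) l N :
    strict_chain P l N ->
  exists s : seq T, uniq s /\ size s = l.
Proof.
move=> [_ Nlt].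
suff: (l <= l)%N -> exists s : seq T,
    [/\ uniq s, size s = l & forall x, x \in s -> x \in N l].
  by move=> /(_ (leqnn _))[s [s_uniq sz _]]; exists s.
elim: {1 3 4}l => [|k IHk] ltkl; first by exists [::].
have [s [s_uniq sz sN]] := IHk (ltnW ltkl); have [NkS NSk] := Nlt k ltkl.
have [x xNS xNk] : exists2 x, x \in N k.+1 & x \notin N k.
  apply: contrapT => none; apply: NSk => x xN; apply: contrapT => /negP xNk.
  by apply: none; exists x.
exists (x :: s); split; rewrite /= ?sz ?s_uniq ?andbT //.
  by apply: contraNN xNk => /sN.
by move=> u; rewrite inE => /predU1P[->|/sN/NkS].
Qed.

Section GradedPiece.
Variables (R : nzRingType) (V : lmodType R) (A B : submod V) (L : eqType).
Variable lam : V -> L.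
(** Here [lam] stands for the n-th coefficient; the condition makes it an injection of A / B into L,
    as sets. *)
Hypothesis lamB : {in A &, forall x y, (lam x == lam y) = (x - y \in B)}.
Local Notation M := (quotient_module A B).

Let valA (x : submodule A) : val x \in A. Proof. exact: (valP x). Qed.

Definition quot_lam (z : M) : L := lam (val (repr z)).

Lemma quot_lam_pi (x : submodule A) : quot_lam (\pi_M%qT x) = lam (val x).
Proof.
apply/eqP; rewrite /quot_lam (lamB (valA _) (valA _)).
have : repr (\pi_M%qT x) - x \in Submod (trace_closed A B).
  by rewrite Quotient.idealrBE reprK.
by [].
Qed.

Lemma quot_lam_inj : injective quot_lam.
Proof.
move=> z w /eqP; rewrite /quot_lam (lamB (valA _) (valA _)) => zw.
rewrite -[z]reprK -[w]reprK; apply/eqP; rewrite -Quotient.idealrBE.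
exact: zw.
Qed.

Lemma quotient_has_length c :
    (forall s : seq L, uniq s ->
       (forall u, u \in s -> exists2 x, x \in A & u = lam x) ->
       (size s <= c)%N) ->
  exists l, has_length M l /\ (l <= c)%N.
Proof.
move=> cardL; have bounded l N :
    strict_chain (fun N : {pred M} => submod_closed N) l N -> (l <= c)%N.
  move=> /strict_chain_size[s [s_uniq <-]]; rewrite -(size_map quot_lam).
  apply: cardL; first by rewrite (map_inj_uniq quot_lam_inj).
  by move=> _ /mapP[z _ ->]; exists (val (repr z)).
have [|l lM] := max_chain_length_exists _ bounded.
  by exists (fun=> true : bool).
by exists l; split=> //; have [[N /bounded]] := lM.
Qed.

(** The preimages of [F 0], ..., [F k] form a strict chain of submodules. *)
Lemma quotient_length_ge (F : nat -> {pred L}) k l :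
    (forall i, (i <= k)%N -> lam 0 \in F i) ->
    (forall i c x y, (i <= k)%N -> x \in A -> y \in A ->
       lam x \in F i -> lam y \in F i -> lam (c *: x + y) \in F i) ->
    (forall i, (i < k)%N -> {subset F i <= F i.+1}) ->
    (forall i, (i < k)%N -> exists x, [/\ x \in A, lam x \in F i.+1
                                        & lam x \notin F i]) ->
  has_length M l -> (k <= l)%N.
Proof.
move=> F0 Flin Fsub Fnew [_ lmax].
apply: (lmax _ (fun i => [pred z : M | quot_lam z \in F i])).
split=> i lei; split.
- rewrite inE -(raddf0 \pi_M%qT) quot_lam_pi raddf0; exact: F0.
- move=> c z w; rewrite !inE => zF wF.
  have -> : c *: z + w = \pi_M%qT (c *: repr z + repr w).
    by rewrite raddfD /= reprK.
  rewrite quot_lam_pi; by apply: Flin => //; apply: valA.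
- by move=> z; rewrite !inE; apply: Fsub.
have [x [xA xFS xF]] := Fnew i lei => /(_ (\pi_M%qT (Sub x xA))).
by rewrite !inE quot_lam_pi SubK xFS (negPf xF) => /(_ isT).
Qed.

End GradedPiece.

(** * Growth of the lengths *)

Lemma mem_valuation_ideal (R : idomainType) (m : {pred R})
    (nu : discrete_valuation {fraction R}) (dom : dominates m nu) n (r : R) :
  (r \in valuation_ideal dom n) = (tofrac r \in val_ge nu n).
Proof. by []. Qed.

Section Growth.
Variables (L : fieldType) (emb : {rmorphism 'F_2 -> L}) (a : nat -> L).
Variable char2 : 2%N \in [pchar L].
Hypothesis aP : forall i, a i ^+ tower_card i = a i + 1.
Local Notation R := (loc (psi emb a)).
Local Notation K := (tower_field char2).

Lemma ord_to_loc_X : fps_ord (loc_val (to_loc (psi emb a) 'X%:P)) = 1%N.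
Proof.
apply: fps_ordE; split=> [[|]//|]; first by rewrite [LHS]psi_X.
by rewrite [X in X != 0]psi_X oner_neq0.
Qed.

Definition curve_dom : dominates (@loc_max _ _ (psi emb a)) _ :=
  loc_dominates ord_to_loc_X.
Local Notation I := (valuation_ideal curve_dom).

Lemma mem_curve_ideal n (r : R) :
  r \in I n <-> (forall i, (i < n)%N -> loc_val r i = 0).
Proof. by rewrite mem_valuation_ideal; apply: loc_valuation_ge. Qed.

Let lam n (r : R^o) : L := loc_val (r : R) n.

Lemma curve_lamB n : {in I n &, forall r r' : R^o,
  (lam n r == lam n r') = (r - r' \in I n.+1)}.
Proof.
move=> r r' /mem_curve_ideal rn /mem_curve_ideal rn'.
rewrite -subr_eq0; apply/eqP/idP => [e|]; last first.
  by move=> /(mem_curve_ideal n.+1 (r - r' : R)).1/(_ n (ltnSn n)).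
apply/(mem_curve_ideal n.+1 (r - r' : R)) => i.
rewrite ltnS leq_eqVlt => /predU1P[-> //|lti].
rewrite [LHS](_ : _ = loc_val (r : R) i - loc_val (r' : R) i) //.
by rewrite rn ?rn' ?subrr.
Qed.

Lemma curve_length n j : (n < gap j)%N ->
  exists l, has_length (quotient_module (I n) (I n.+1)) l /\
            (l <= tower_card j)%N.
Proof.
move=> ltnj; apply: (quotient_has_length (@curve_lamB n)) => s s_uniq sP.
apply: (card_tower_field (char2 := char2) s_uniq) => u /sP[r rI ->].
by apply: loc_tower_field => //; apply/mem_curve_ideal.
Qed.

Lemma curve_length_unbounded k : exists n, forall l,
  has_length (quotient_module (I n) (I n.+1)) l -> (k <= l)%N.
Proof.
have [n nP] : exists n, forall i, (i < k)%N -> exists r : R,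
    [/\ forall m, (m < n)%N -> loc_val r m = 0, loc_val r n \in K i.+1
      & loc_val r n \notin K i].
  elim: k => [|k [n nP]]; first by exists 0%N.
  (* Multiplication by X^d moves a lowest coefficient up by d degrees unchanged, which brings all
     witnesses to one common degree. *)
  have raise m d (r : R) : (forall i, (i < m)%N -> loc_val r i = 0) ->
      exists r' : R, (forall i, (i < d + m)%N -> loc_val r' i = 0) /\
                     loc_val r' (d + m)%N = loc_val r m.
    move=> rm; elim: d => [|d [r' [rd rE]]]; first by exists r.
    exists (to_loc (psi emb a) 'X%:P * r').
    have X0 i : (i < 1)%N -> loc_val (to_loc (psi emb a) 'X%:P) i = 0.
      by case: i => // _; rewrite [LHS]psi_X.
    have [z e] := fps_coefM_ord X0 rd.
    by split=> [i /z|] //; rewrite -rE [LHS]e [X in X * _]psi_X mul1r.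
  have [p [m [pm pK pnK]]] := psi_new_coefficient emb char2 aP k.
  exists (m + n)%N => i; rewrite ltnS leq_eqVlt.
  case/predU1P=> [->|/nP[r [rn rK rnK]]].
    have [r [rmn rE]] := @raise m n (to_loc _ p) pm; rewrite addnC.
    by exists r; split; rewrite ?rE.
  have [r' [rmn rE]] := @raise n m r rn.
  by exists r'; split; rewrite ?rE.
exists n => l; apply: (quotient_length_ge (@curve_lamB n) (F := K)).
- by move=> i _; apply: tower_field0.
- move=> i c x y _ xI yI xK yK.
  have cn j : (j < 0)%N -> loc_val (c : R) j = 0 by [].
  have xn := (mem_curve_ideal n x).1 xI.
  (* Scalars act on the n-th coefficient through their constant term, which lies in K_0. *)
  have -> : lam n (c *: x + y) = loc_val (c : R) 0%N * lam n x + lam n y.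
    by rewrite -(fps_coefM_ord cn xn).2.
  rewrite tower_fieldD // tower_fieldM //.
  by apply: (@tower_field_le _ _ 0) => //; apply: loc_tower_field.
- by move=> i _ x; apply: tower_field_le.
move=> i /nP[r [rn rK rnK]]; exists r; split=> //.
exact/mem_curve_ideal.
Qed.

(** Choose j with [gap j <= n < gap j.+1]. The length is at most [tower_card j.+1], whose square is
    [gap j]. *)
Lemma curve_length_sqr n l : (gap 0 <= n)%N ->
  has_length (quotient_module (I n) (I n.+1)) l -> (l ^ 2 <= n)%N.
Proof.
move=> n0 nl; have exj : exists j, (n < gap j)%N by exists n; apply: gap_gt.
case: (ex_minnP exj) => -[|j] ltnj jmin; first by rewrite ltnNge n0 in ltnj.
have [l' [nl' lel']] := curve_length ltnj.
have lel : (l <= l')%N.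
  by have [[N /nl'.2]] := nl.
have lejn : (gap j <= n)%N by rewrite leqNgt; apply/negP => /jmin; rewrite ltnn.
by apply: leq_trans lejn; rewrite /gap tower_cardS leq_sqr (leq_trans lel).
Qed.

End Growth.

(** * Quasi-polynomials with square-root growth *)

Section QuasiPolynomialGrowth.
Variable T : realType.

(** If q were not constant, q^2 would have degree at least 2, and q^2 - (b X + c) would have
    positive leading coefficient and be positive at large integers. *)
Lemma poly_sublinear_const (q : {poly T}) (b c : T) m0 :
    (forall m : nat, (m0 <= m)%N -> q.[m%:R] ^+ 2 <= b * m%:R + c) ->
  (size q <= 1)%N.
Proof.
move=> qle; rewrite leqNgt; apply/negP => sq.
pose l := b *: 'X + c%:P; pose g := q ^+ 2 - l.
have sl : (size l <= 2)%N.
  rewrite (leq_trans (size_polyD _ _)) // geq_max.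
  rewrite (leq_trans (size_scale_leq _ _)) ?size_polyX //=.
  by rewrite (leq_trans (size_polyC_leq1 _)).
have q0 : q != 0 by rewrite -size_poly_gt0 ltnW.
have slq : (size (- l)%R < size (q ^+ 2)%R)%N.
  rewrite size_polyN; have := size_exp q 2; move: sl sq.
  by move: (size l) (size q) (size (q ^+ 2)%R) => u v w; lia.
have lg : 0 < lead_coef g.
  rewrite /g lead_coefDl // lead_coef_exp exprn_even_gt0 //=.
  by rewrite lead_coef_eq0.
have [x gx] := poly_pinfty_gt_lc lg.
pose m := maxn m0 (Num.bound `|x|).
have xm : x <= m%:R.
  apply: le_trans (ler_norm x) (le_trans (_ : _ <= (Num.bound `|x|)%:R) _).
    exact/ltW/archi_boundP.
  by rewrite ler_nat leq_maxr.
have := lt_le_trans lg (gx _ xm); rewrite /g !hornerE subr_gt0 ltNge.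
by rewrite qle ?leq_maxl.
Qed.

Lemma int_periodicM (f : int -> T) p k n :
  (forall m, f (m + p) = f m) -> f (n + p * Posz k) = f n.
Proof.
move=> fp; elim: k => [|k IHk]; first by rewrite mulr0 addr0.
by rewrite -addn1 PoszD mulrDr mulr1 addrA fp.
Qed.

Lemma common_period d (f : 'I_d -> int -> T) :
    (forall i, int_periodic (f i)) ->
  exists2 p : nat, (0 < p)%N & forall i n k, f i (n + Posz (p * k)) = f i n.
Proof.
move=> fper; have per i :
    exists p : nat, (0 < p)%N /\ forall n, f i (n + Posz p) = f i n.
  by have [[p|p] // p0 fp] := fper i; exists p.
pose P i := sval (cid (per i)); exists (\prod_i P i)%N.
  by rewrite prodn_gt0 // => i; rewrite /P; case: cid => p [].
move=> i n k; rewrite (bigD1 i) //= -mulnA PoszM; apply: int_periodicM.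
by rewrite /P; case: cid => p [].
Qed.

(** On each residue class modulo a common period p, Q is a polynomial in the quotient. The growth
    bound makes it constant, so Q takes finitely many values on the naturals and f would be
    bounded. *)
Lemma sqrt_growth_not_quasi_polynomial (f : nat -> nat) n1 :
    (forall n, (n1 <= n)%N -> (f n ^ 2 <= n)%N) ->
    (forall k, exists n, (k <= f n)%N) ->
  ~ eventually_quasi_polynomial_plus_bounded (fun n => (f n)%:R : T).
Proof.
move=> fsqr funb [Q [s [[d [c [cper QE]]] [M sM] [n0 fE]]]].
have [p p0 cp] := common_period cper.
have M0 : 0 <= M by apply: le_trans (sM 0).
pose q (r : nat) : {poly T} :=
  \sum_(i < d.+1) c i r *: (r%:R%:P + p%:R *: 'X) ^+ i.
have qE r m : (q r).[m%:R] = Q (r + p * m)%N.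
  rewrite QE horner_sum; apply: eq_bigr => i _.
  rewrite PoszD cp !hornerE; congr (_ * _ ^+ _).
  by rewrite rmorphD /= -!pmulrn natrM.
have qconst r m : (q r).[m%:R] = (q r)`_0.
  suff /size1_polyC -> : (size (q r) <= 1)%N by rewrite hornerC coefC.
  pose m0 := (n0 + n1)%N.
  (* The constants come from (f - s)^2 <= 2 f^2 + 2 s^2, with f^2 <= n = r + p k and s^2 <= M^2. *)
  apply: (@poly_sublinear_const _ (2 * p%:R) (2 * r%:R + 2 * M ^+ 2) m0).
  move=> k lek; set n := (r + p * k)%N.
  have len : (m0 <= n)%N.
    by rewrite (leq_trans lek) // /n (leq_trans _ (leq_addl _ _)) // leq_pmull.
  have fn : (f n)%:R ^+ 2 <= n%:R :> T.
    by rewrite -natrX ler_nat fsqr // (leq_trans _ len) ?leq_addl.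
  have sn : s n ^+ 2 <= M ^+ 2.
    by rewrite -real_normK ?num_real // lerXn2r ?nnegrE.
  have -> : (q r).[k%:R] = (f n)%:R - s n.
    by rewrite qE fE ?addrK // (leq_trans _ len) ?leq_addr.
  have nE : n%:R = r%:R + p%:R * k%:R :> T by rewrite natrD natrM.
  rewrite nE in fn; have := sqr_ge0 ((f n)%:R + s n); nra.
(* The summands account for the p constants, the bounded error, and the values before [n0]. *)
pose B : T := \sum_(r < p) `|(q r)`_0| + M + \sum_(n < n0) (f n)%:R.
have fB n : (f n)%:R <= B.
  have sum1 : 0 <= \sum_(r < p) `|(q r)`_0| by apply: sumr_ge0.
  have sum2 : 0 <= \sum_(n < n0) (f n)%:R :> T by apply: sumr_ge0.
  have [ltn|len] := ltnP n n0.
    rewrite /B -[X in X <= _]add0r lerD ?addr_ge0 //.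
    rewrite (bigD1 (Ordinal ltn)) //= lerDl; exact: sumr_ge0.
  rewrite /B -[X in X <= _]addr0 lerD // fE // lerD //; last first.
    by apply: le_trans (ler_norm _) (sM _).
  have -> : Q n = (q (n %% p)%N)`_0.
    by rewrite -(qconst _ (n %/ p)%N) qE mulnC addnC -divn_eq.
  rewrite (bigD1 (Ordinal (ltn_pmod n p0))) //=.
  by rewrite ler_wpDr ?ler_norm ?sumr_ge0.
have [n] := funb (Num.bound B); rewrite leqNgt => /negP; apply.
rewrite -(ltr_nat T); apply: le_lt_trans (fB n) (archi_boundP _).
exact: le_trans (ler0n _ 0) (le_trans _ (fB 0%N)).
Qed.

End QuasiPolynomialGrowth.

(** * Existence of the coefficients over the algebraic closure of F_2, and the resulting example *)

Lemma tower_generators : exists (L : fieldType) (emb : {rmorphism 'F_2 -> L})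
  (a : nat -> L), forall i, a i ^+ tower_card i = a i + 1.
Proof.
have [L [emb _]] := @countable_algebraic_closure 'F_2.
suff /choice[a aP] : forall i, exists x : L, x ^+ tower_card i = x + 1.
  by exists L, emb, a.
move=> i; pose p : {poly L} := 'X^(tower_card i) - ('X + 1).
have sp : size p = (tower_card i).+1.
  rewrite size_polyDl size_polyXn // size_polyN -polyC1 size_XaddC.
  by rewrite ltnS tower_card_gt1.
have [x] : exists x, root p x.
  by apply/closed_rootP; rewrite sp eqSS -lt0n expn_gt0.
by rewrite rootE !hornerE subr_eq0 => /eqP; exists x.
Qed.

Theorem theorem4p11 (T : realType) :
  exists (R : idomainType) (m : {pred R})
         (nu : discrete_valuation {fraction R}) (dom : dominates m nu)
         (alpha : nat -> nat),
    [/\ regular_local_ring m 2,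
        forall n : nat,
          has_length (quotient_module (valuation_ideal dom n)
                                      (valuation_ideal dom n.+1)) (alpha n)
      & ~ eventually_quasi_polynomial_plus_bounded
            (fun n : nat => (alpha n)%:R : T)].
Proof.
have [L [emb [a aP]]] := tower_generators.
have char2 : 2%N \in [pchar L].
  by rewrite (rmorph_pchar emb) // pchar_Fp.
pose dom := curve_dom emb a.
have lengths n : exists l, has_length
    (quotient_module (valuation_ideal dom n) (valuation_ideal dom n.+1)) l.
  by have [l [nl _]] := curve_length emb char2 aP (gap_gt n); exists l.
have [alpha alphaP] := choice lengths.
exists (loc (psi emb a)), (@loc_max _ _ (psi emb a)), _, dom, alpha; split=> //.
  apply: regular_local_plane; last exact: psi_eq00.
  exact/psi_inj/(tower_generator_neq0 char2 aP).
apply: (@sqrt_growth_not_quasi_polynomial _ _ (gap 0)) => [n n0|k].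
  exact: (curve_length_sqr char2 aP n0 (alphaP n)).
have [n nP] := curve_length_unbounded emb char2 aP k.
by exists n; apply: nP.
Qed.
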